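(* Every $2$-tree admits a reducible outside-obstacle representation (OOR) in which every vertex is incident to the outer face.
   Context: All graphs are finite and simple. The graph class of $2$-trees is recursively defined as follows: $K_3$ is a $2$-tree; further, any graph is a $2$-tree if it is obtained from a $2$-tree $H$ by introducing a new vertex $x$ and making $x$ adjacent to exactly the two endpoints of some edge $uv$ of $H$. A straight-line drawing $\Gamma$ of a graph $G$ maps the vertices to pairwise distinct points of $\mathbb{R}^2$ and each edge to the closed line segment between its endpoints. The outer face of $\Gamma$ is the unbounded connected component of the complement in $\mathbb{R}^2$ of the union of all vertex points and edge segments. The planarization of $\Gamma$ is obtained by replacing all intersection points of edges by dummy vertices (so edges are subdivided at crossings). A non-edge of $G$ is a pair of distinct non-adjacent vertices; it is identified with the line segment between its endpoints. An outside-obstacle representation (OOR) of $G$ is a straight-line drawing of $G$ such that no edge segment contains a vertex point other than its two endpoints and every non-edge segment intersects the outer face of the drawing. (Equivalently, $G$ is the visibility graph of the point set with respect to a single obstacle, namely the open outer face of the drawing.) An OOR is reducible if every edge is incident to the outer face, i.e., for every edge at least one of the sub-segments into which it is divided in the planarization lies on the boundary of the outer face. A vertex is incident to the outer face if its point lies on the boundary of the outer face. *)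

(* Defs.v *)
From HB Require Import structures.
From mathcomp Require Import all_boot all_order all_algebra.
From mathcomp Require Import all_classical all_reals all_analysis.

Set Implicit Arguments.
Unset Strict Implicit.
Unset Printing Implicit Defensive.

Import Order.TTheory GRing.Theory Num.Theory.
Import numFieldNormedType.Exports.

Local Open Scope classical_set_scope.
Local Open Scope ring_scope.

Record sgraph := SGraph {
  vertex :> finType;
  adj : rel vertex;
  adj_sym : symmetric adj;
  adj_irrefl : irreflexive adj }.

Definition isomorphic (G H : sgraph) : Prop :=
  exists f : G -> H, bijective f /\ {mono f : x y / adj x y}.

Section CompleteGraph.
Variable n : nat.

Definition complete_rel : rel 'I_n := fun x y => x != y.

Lemma complete_rel_sym : symmetric complete_rel.
Proof. by move=> x y; rewrite /complete_rel eq_sym. Qed.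

Lemma complete_rel_irrefl : irreflexive complete_rel.
Proof. by move=> x; rewrite /complete_rel eqxx. Qed.

Definition complete_graph : sgraph :=
  SGraph complete_rel_sym complete_rel_irrefl.

End CompleteGraph.

Section Extend.
Variables (H : sgraph) (u v : H).

(* [None] is the new vertex, [Some] embeds the vertices of [H]. *)
Definition extend_rel : rel (option H) := fun x y =>
  match x, y with
  | Some a, Some b => adj a b
  | Some a, None | None, Some a => (a == u) || (a == v)
  | None, None => false
  end.

Lemma extend_rel_sym : symmetric extend_rel.
Proof. by move=> [a|] [b|] //=; rewrite adj_sym. Qed.

Lemma extend_rel_irrefl : irreflexive extend_rel.
Proof. by move=> [a|] //=; rewrite adj_irrefl. Qed.

Definition extend : sgraph := SGraph extend_rel_sym extend_rel_irrefl.

End Extend.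

Inductive two_tree : sgraph -> Prop :=
| two_tree_K3 : two_tree (complete_graph 3)
| two_tree_extend (H : sgraph) (u v : H) :
    two_tree H -> adj u v -> two_tree (extend u v)
| two_tree_iso (G H : sgraph) :
    isomorphic G H -> two_tree G -> two_tree H.

(* The norm on [R * R] is the sup norm; it induces the usual topology and the
   usual bounded sets of the plane. *)
Definition segment (R : realType) (a b : R * R) : set (R * R) :=
  (fun t : R => (1 - t) *: a + t *: b) @` `[0, 1].

Definition boundary (T : topologicalType) (A : set T) : set T :=
  closure A `\` A^°.

Section Drawing.
Variables (R : realType) (G : sgraph) (p : G -> R * R).

Definition drawing_set : set (R * R) :=
  range p `|`
  [set z | exists u v : G, adj u v /\ segment (p u) (p v) z].

(* [drawing_set] is compact, so exactly one connected component of its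
   complement is unbounded. *)
Definition outer_face : set (R * R) :=
  [set z | (~` drawing_set) z /\
           ~ bounded_set (connected_component (~` drawing_set) z)].

Definition is_OOR : Prop :=
  [/\ injective p,
      forall u v w : G, adj u v -> segment (p u) (p v) (p w) ->
        w = u \/ w = v
    & forall u v : G, u != v -> ~~ adj u v ->
        segment (p u) (p v) `&` outer_face !=set0].

Definition planarization_vertex (z : R * R) : Prop :=
  range p z \/
  exists u v u' v' : G,
    [/\ adj u v /\ adj u' v', (u', v') <> (u, v) /\ (u', v') <> (v, u),
        segment (p u) (p v) z & segment (p u') (p v') z].

(* [a] and [b] are the ends of one of the sub-segments into which the edge
   [uv] is divided in the planarization. *)
Definition planarization_edge (u v : G) (a b : R * R) : Prop :=
  [/\ a != b,
      segment (p u) (p v) a /\ planarization_vertex a,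
      segment (p u) (p v) b /\ planarization_vertex b
    & forall z, segment a b z -> planarization_vertex z -> z = a \/ z = b].

Definition is_reducible : Prop :=
  forall u v : G, adj u v -> exists a b : R * R,
    planarization_edge u v a b /\ segment a b `<=` boundary outer_face.

Definition vertex_on_outer_face (v : G) : Prop := boundary outer_face (p v).

End Drawing.

(* Main.v *)
(* The drawing is grown one vertex at a time. Orient every edge towards the
   endpoint that was placed later. The invariant is that (1) the prolongation of
   an oriented edge ab beyond b starts in the outer face, and (2) every edge ab
   has a point that is reached from the outer face from the side of ab
   containing no common neighbour of a and b. To stack x on an edge uv with v
   the later endpoint, put x at v + s f + s^2 g, where f = v - u, the normal g
   points to the side of uv left free by (2), and s is tiny. Near v the old
   drawing avoids a thin cone around the prolongation of uv, and there the
   triangle uvx is a sliver seen from three sides: from beyond x, and from the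
   outer sides of ux and of vx. These give the witnesses for the new edges and
   for the non-edges at x, and all old witnesses survive because the new edges
   lie close to uv. *)

From HB Require Import structures.
From mathcomp Require Import all_boot all_order all_algebra.
From mathcomp Require Import all_classical all_reals all_analysis.
From mathcomp Require Import ring lra.
Require Import Defs.
Set Implicit Arguments.
Unset Strict Implicit.
Unset Printing Implicit Defensive.

Import Order.TTheory GRing.Theory Num.Theory.
Import numFieldNormedType.Exports.

Local Open Scope classical_set_scope.
Local Open Scope ring_scope.

(** Closeness alone preserves only witnesses away from [u] and [v]; [escapes] records a positive
    distance for exactly this purpose. It says nothing about the edge [uv] itself, the prolongations
    that start at [u] or [v], and the non-edges from [x] to neighbours of [v], where the distance to
    the new edges is zero or tends to zero. There, directions ([diverge]) and sides of a line
    ([orient]) are compared instead. The new vertex goes to the side of [uv] opposite to the witness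
    [z] of (2), the side on which all common neighbours of [u] and [v] lie already. So the old
    witness of [uv] stays valid. Moreover every other earlier neighbour of [v] is such a common
    neighbour, hence its prolongation beyond [v] enters the side that [x] does not use. The height
    [s^2] is nonzero, yet gives slope [s] at [v], which finally drops below the opening of any fixed
    cone. Every requirement holds for all small [s > 0], and there are finitely many, so one [s]
    serves them all. *)

Lemma compact_finite_union (T : topologicalType) (I : finType) (F : I -> set T) :
  (forall i, compact (F i)) -> compact [set z | exists i, F i z].
Proof.
move=> cF; have -> : [set z | exists i, F i z] =
    \big[setU/set0]_(i <- enum I) F i.
  rewrite -bigcup_seq; apply/seteqP; split => [z [i Fiz]|z [i _ Fiz]]; exists i => //=.
  by rewrite mem_enum.
exact: bigsetU_compact.
Qed.

(** * Segments and their distances *)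

Section Segments.
Variable R : realType.
Local Notation P := (R * R)%type.
Implicit Types (a b c d z : P) (A B D : set P) (t : R).

Definition pt a b t : P := (1 - t) *: a + t *: b.

Lemma pt1 a b t : (pt a b t).1 = (1 - t) * a.1 + t * b.1. Proof. by []. Qed.
Lemma pt2 a b t : (pt a b t).2 = (1 - t) * a.2 + t * b.2. Proof. by []. Qed.

Lemma fstD a b : (a + b).1 = a.1 + b.1. Proof. by []. Qed.
Lemma sndD a b : (a + b).2 = a.2 + b.2. Proof. by []. Qed.
Lemma fstN a : (- a).1 = - a.1. Proof. by []. Qed.
Lemma sndN a : (- a).2 = - a.2. Proof. by []. Qed.
Lemma fstZ t a : (t *: a).1 = t * a.1. Proof. by []. Qed.
Lemma sndZ t a : (t *: a).2 = t * a.2. Proof. by []. Qed.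
Definition coordE := (pt1, pt2, fstD, sndD, fstN, sndN, fstZ, sndZ).

Lemma pair_eq (a b : P) : a.1 = b.1 -> a.2 = b.2 -> a = b.
Proof. by case: a b => ? ? [? ?] /= -> ->. Qed.

Lemma segmentP a b z :
  segment a b z <-> exists t, [/\ 0 <= t, t <= 1 & z = pt a b t].
Proof.
split=> [[t /= /[!in_itv] /= /andP[t0 t1] <-]|[t [t0 t1 ->]]]; first by exists t.
by exists t => //=; rewrite in_itv /= t0.
Qed.

Lemma segment_pt a b t : 0 <= t -> t <= 1 -> segment a b (pt a b t).
Proof. by move=> t0 t1; apply/segmentP; exists t. Qed.

Lemma pt_0 a b : pt a b 0 = a.
Proof. by rewrite /pt subr0 scale1r scale0r addr0. Qed.

Lemma pt_1 a b : pt a b 1 = b.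
Proof. by rewrite /pt subrr scale0r scale1r add0r. Qed.

Lemma pt_sym a b t : pt a b t = pt b a (1 - t).
Proof. by rewrite /pt subKr addrC. Qed.

Lemma pt_pt a b s t u : pt (pt a b s) (pt a b t) u = pt a b ((1 - u) * s + u * t).
Proof. by apply: pair_eq; rewrite !coordE; ring. Qed.

Lemma segment_l a b : segment a b a.
Proof. by apply/segmentP; exists 0; rewrite pt_0. Qed.

Lemma segment_r a b : segment a b b.
Proof. by apply/segmentP; exists 1; rewrite pt_1. Qed.

Lemma segmentC a b : segment a b = segment b a.
Proof.
apply/seteqP; split=> z /segmentP[t [t0 t1 ->]]; rewrite pt_sym;
  apply: segment_pt; lra.
Qed.

Lemma pt_continuous a b : continuous (pt a b).
Proof.
move=> t; rewrite /pt.
apply: cvgD; apply: cvgZr_tmp => //; apply: cvgB => //; exact: cvg_cst.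
Qed.

Lemma segment_compact2 a b : compact (segment a b).
Proof.
apply: (@continuous_compact _ _ (pt a b)); last exact: segment_compact.
exact/continuous_subspaceT/pt_continuous.
Qed.

Lemma segment_connected2 a b : connected (segment a b).
Proof.
apply: (@connected_continuous_connected _ _ _ (pt a b)); first exact: segment_connected.
exact/continuous_subspaceT/pt_continuous.
Qed.

Lemma norm_pt_sub a b c d t : 0 <= t -> t <= 1 ->
  `|pt a b t - pt c d t| <= Num.max `|a - c| `|b - d|.
Proof.
move=> t0 t1.
have -> : pt a b t - pt c d t = (1 - t) *: (a - c) + t *: (b - d).
  by apply: pair_eq; rewrite !coordE; ring.
apply: (le_trans (ler_normD _ _)); rewrite !normrZ ger0_norm ?subr_ge0//.
rewrite (ger0_norm t0).
set m := Num.max _ _.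
have m1 : `|a - c| <= m by rewrite le_max lexx.
have m2 : `|b - d| <= m by rewrite le_max lexx orbT.
have -> : m = (1 - t) * m + t * m by ring.
by apply: lerD; apply: ler_wpM2l => //; rewrite subr_ge0.
Qed.

Lemma norm_pt_l a b t : 0 <= t -> t <= 1 -> `|pt a b t - a| <= `|b - a|.
Proof.
move=> t0 t1; have := @norm_pt_sub a b a a t t0 t1.
have -> : pt a a t = a by apply: pair_eq; rewrite !coordE; ring.
by rewrite subrr normr0 maxC/= max_l.
Qed.

Lemma pos_dist A B : compact A -> compact B -> A `&` B = set0 ->
  exists2 e : R, 0 < e & forall a b, A a -> B b -> e <= `|a - b|.
Proof.
move=> cA cB AB0.
have [[[a0 b0] [/= Aa0 Bb0]]|nAB] := pselect (A `*` B !=set0); last first.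
  (* If one of the sets is empty, any positive bound is vacuously valid. *)
  by exists 1 => // a b Aa Bb; exfalso; apply: nAB; exists (a, b).
pose f := fun x : P * P => `|x.1 - x.2| : R.
have cf : continuous f.
  move=> x; apply: (@continuous_comp _ _ _ (fun x : P * P => x.1 - x.2) Num.norm).
    by apply: cvgB; [exact: cvg_fst|exact: cvg_snd].
  exact: norm_continuous.
have [||[a b] /[!inE] -[/= Aa Bb] fmin] := @compact_EVT_min _ _ f (A `*` B) _ (compact_setX cA cB).
- by exists (a0, b0).
- exact: continuous_subspaceT.
exists (f (a, b)).
  rewrite normr_gt0 subr_eq0; apply/eqP => /= ab.
  have : (A `&` B) a by split => //; rewrite ab.
  by rewrite AB0.
by move=> a' b' Aa' Bb'; apply: (fmin (a', b')); rewrite inE.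
Qed.

End Segments.

(** * Points of the outer face *)

Section Escape.
Variable R : realType.
Local Notation P := (R * R)%type.
Implicit Types (a b c d z : P) (C D : set P) (t : R).

(* [z] lies in the unbounded component of the complement of [D], with a witness
   at positive distance from [D], so that it survives a small change of [D]. *)
Definition escapes D z := exists C (e : R),
  [/\ connected C, C z, ~ bounded_set C, 0 < e
    & forall c d, C c -> D d -> e <= `|c - d| ].

(** Twice the signed area of the triangle [abc]; its sign gives the side of the line [ab]. *)
Definition orient a b c : R :=
  (b.1 - a.1) * (c.2 - a.2) - (b.2 - a.2) * (c.1 - a.1).

Lemma orient_pt a b c d t : orient a b (pt c d t) = (1 - t) * orient a b c + t * orient a b d.
Proof. by rewrite /orient !coordE; ring. Qed.

Lemma orient_segment a b z : segment a b z -> orient a b z = 0.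
Proof. by move=> /segmentP[t [_ _ ->]]; rewrite /orient !coordE; ring. Qed.

(** Parameter 0 is left out because [m] is meant to lie on the drawing, as a vertex or a point of an
    edge. *)
Definition clear D m z := forall t, 0 < t -> t <= 1 -> ~ D (pt m z t).

Lemma bounded_setS C D : C `<=` D -> bounded_set D -> bounded_set C.
Proof. by move=> CD [M [Mr DM]]; exists M; split => // x Mx y /CD; exact: DM. Qed.

Lemma escapes_notin D z : escapes D z -> ~ D z.
Proof.
move=> [C [e [_ Cz _ e0 CD]]] Dz.
by have := CD z z Cz Dz; rewrite subrr normr0 leNgt e0.
Qed.

(** The old distance is split in three: displacement of the point, displacement of the drawing, and
    what remains. The unbounded set is enlarged by the segment from [z] to [z']. *)
Lemma escapes_near D z : escapes D z -> exists2 e : R, 0 < e &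
  forall D' z', (forall d', D' d' -> exists2 d, D d & `|d' - d| < e) ->
    `|z' - z| < e -> escapes D' z'.
Proof.
move=> [C [e [cC Cz nbC e0 CD]]]; exists (e / 3); first by lra.
move=> D' z' DD' zz'; exists (C `|` segment z z'), (e / 3); split; last 1 first.
- move=> c d' Cc /DD'[d Dd dd'].
  have [y Cy cy] : exists2 y, C y & `|c - y| < e / 3.
    case: Cc => [Cc|/segmentP[t [t0 t1 ->]]].
      by exists c => //; rewrite subrr normr0; lra.
    by exists z => //; apply: le_lt_trans zz'; apply: norm_pt_l.
  have := CD _ _ Cy Dd; have -> : y - d = (c - d') - (c - y) + (d' - d).
    by apply: pair_eq; rewrite !coordE; ring.
  move=> h; have := le_trans h (le_trans (ler_normD _ _) (lerD (ler_normB _ _) (lexx _))).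
  by lra.
- apply: connectedU => //; last exact: segment_connected2.
  by exists z; split => //; exact: segment_l.
- by right; exact: segment_r.
- by move/(bounded_setS (@subsetUl _ C (segment z z'))).
- by lra.
Qed.

Lemma escapes_step D z z' : compact D -> (forall y, segment z z' y -> ~ D y) ->
  escapes D z -> escapes D z'.
Proof.
move=> cD zz' [C [e [cC Cz nbC e0 CD]]].
have [|e' e'0 He'] := pos_dist (@segment_compact2 _ z z') cD.
  by rewrite -subset0 => y [/zz'].
exists (C `|` segment z z'), (Num.min e e'); split.
- apply: connectedU => //; last exact: segment_connected2.
  by exists z; split => //; exact: segment_l.
- by right; exact: segment_r.
- by move/(bounded_setS (@subsetUl _ C (segment z z'))).
- by rewrite lt_min e0.
- move=> c d [Cc|Cc] Dd; rewrite ge_min; apply/orP.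
    by left; exact: CD.
  by right; exact: He'.
Qed.

Lemma escapes_clear D m z t : compact D -> clear D m z -> escapes D z ->
  0 < t -> t <= 1 -> escapes D (pt m z t).
Proof.
move=> cD mz zD t0 t1; apply: (escapes_step cD _ zD) => y.
move=> /segmentP[u [u0 u1 ->]].
rewrite -{1}(pt_1 m z) pt_pt; apply: mz; nra.
Qed.

Lemma escapes_ray D z (v : P) (e : R) : v != 0 -> 0 < e ->
  (forall t d, 0 <= t -> D d -> e <= `|z + t *: v - d|) -> escapes D z.
Proof.
move=> v0 e0 zD; exists [set z + t *: v | t in `[0, +oo[], e; split => //.
- apply: connected_continuous_connected.
    exact/connected_intervalP/interval_is_interval.
  apply/continuous_subspaceT => t; apply: cvgD; first exact: cvg_cst.
  by apply: cvgZr_tmp.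
- by exists 0; rewrite /= ?in_itv /= ?lexx // scale0r addr0.
- move=> /ex_strict_bound_gt0[M M0 /= zM].
  have nv : 0 < `|v| by rewrite normr_gt0.
  pose t := (M + `|z|) / `|v|.
  have t0 : 0 <= t by rewrite divr_ge0 // addr_ge0 // ltW.
  have := zM (z + t *: v) _; rewrite /=.
  have : `|t *: v| <= `|z + t *: v| + `|z|.
    by have := ler_normB (z + t *: v) z; rewrite addrC addKr.
  rewrite normrZ ger0_norm // /t mulfVK ?gt_eqF // => h1 h2.
  have {}h2 : `|z + t *: v| < M by apply: h2; exists t => //; rewrite in_itv /= t0.
  by move: h1; rewrite -/t; lra.
- by move=> c d [t /=]; rewrite in_itv /= andbT => t0 <- Dd; exact: zD.
Qed.

End Escape.

(** * Compactness of drawings, the outer face and planarization vertices *)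

Section DrawingTopology.
Variables (R : realType) (G : sgraph) (p : G -> R * R).
Implicit Types (a b u v w : G) (z m : R * R).

(** The relation is a parameter so that one compactness proof serves both the drawing and
    [other_edges]. *)
Definition edges_set (E : rel G) : set (R * R) :=
  range p `|` [set z | exists u v : G, E u v /\ segment (p u) (p v) z].

Lemma edges_set_compact E : compact (edges_set E).
Proof.
apply: compactU.
  have -> : range p = [set z | exists w, [set p w] z].
    by apply/seteqP; split => [_ [w _ <-]|_ [w ->]]; exists w.
  by apply: compact_finite_union => w; exact: compact_set1.
have -> : [set z | exists u v : G, E u v /\ segment (p u) (p v) z] =
    [set z | exists uv : G * G, (if E uv.1 uv.2 then segment (p uv.1) (p uv.2) else set0) z].
  apply/seteqP; split => [z [u [v [Euv uvz]]]|z [[u v] /=]].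
    by exists (u, v); rewrite /= Euv.
  by case: ifP => // Euv uvz; exists u, v.
apply: compact_finite_union => -[u v] /=.
by case: ifP => _; [exact: segment_compact2|exact: compact0].
Qed.

Lemma drawing_compact : compact (drawing_set p).
Proof. exact: edges_set_compact. Qed.

Lemma escapes_outer z : escapes (drawing_set p) z -> outer_face p z.
Proof.
move=> zD; split; first exact: escapes_notin zD.
case: zD => C [e [cC Cz nbC e0 CD]] bD; apply: nbC.
apply: bounded_setS bD; apply: connected_component_max => //.
by move=> c Cc Dc; have := CD c c Cc Dc; rewrite subrr normr0 leNgt e0.
Qed.

Lemma boundary_outer z : drawing_set p z -> closure (outer_face p) z ->
  boundary (outer_face p) z.
Proof. by move=> Dz cz; split => // /interior_subset[]. Qed.

Lemma closure_approx (A : set (R * R)) z :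
  (forall e : R, 0 < e -> exists2 y, A y & `|z - y| < e) -> closure A z.
Proof.
move=> h B /nbhs_ballP[e /= e0 zB]; have [y Ay yz] := h e e0.
by exists y; split => //; apply: zB; rewrite ball_prod_normE.
Qed.

(** All vertex points are kept, those of [a] and [b] included, so that on the edge [ab] this is the
    set of planarization vertices. *)
Definition other_edges a b : set (R * R) := edges_set
  [rel x y | [&& adj x y, (x, y) != (a, b) & (x, y) != (b, a)]].

Lemma other_edgesP a b z : other_edges a b z <-> range p z \/
  exists c d, [/\ adj c d, (c, d) != (a, b), (c, d) != (b, a) & segment (p c) (p d) z].
Proof.
split=> [[?|[c [d [/= /and3P[cd n1 n2] cdz]]]]|[?|[c [d [cd n1 n2 cdz]]]]];
  by [left|right; exists c, d; split => //=; apply/and3P].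
Qed.

Lemma other_edgesC a b : other_edges a b = other_edges b a.
Proof.
rewrite /other_edges; congr edges_set.
by apply/funext => x; apply/funext => y /=; case: adj => //=; rewrite andbC.
Qed.

Lemma drawing_other a b z : adj a b ->
  drawing_set p z <-> other_edges a b z \/ segment (p a) (p b) z.
Proof.
move=> ab; split=> [[zp|[x [y [xy xyz]]]]|[[zp|[x [y [/= /and3P[xy _ _] xyz]]]]|zab]].
- by left; left.
- have [[xa yb]|n1] := eqVneq (x, y) (a, b); first by right; rewrite -xa -yb.
  have [[xb ya]|n2] := eqVneq (x, y) (b, a).
    by right; rewrite segmentC -xb -ya.
  by left; right; exists x, y; split => //=; rewrite xy n1.
- by left.
- by right; exists x, y.
- by right; exists a, b.
Qed.

Lemma planarization_vertexP a b z : adj a b -> segment (p a) (p b) z ->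
  planarization_vertex p z <-> other_edges a b z.
Proof.
move=> ab zab; split=> [[zp|[u [v [u' [v' [[uv uv'] [n1 n2] z1 z2]]]]]]|[zp|]].
- by left.
- have [[ua vb]|m1] := eqVneq (u, v) (a, b); first subst.
    by right; exists u', v'; split => //=; rewrite uv' /=; apply/andP; split; apply/eqP.
  have [[ua vb]|m2] := eqVneq (u, v) (b, a); first subst.
    by right; exists u', v'; split => //=; rewrite uv' /=; apply/andP; split; apply/eqP.
  by right; exists u, v; split => //=; rewrite uv m1.
- by left.
- move=> [u [v [/= /and3P[uv /eqP n1 /eqP n2] uvz]]].
  by right; exists a, b, u, v; split.
Qed.

End DrawingTopology.

(** * From escaping witnesses to the boundary of the outer face *)

Section Conclusions.
Variables (R : realType) (G : sgraph) (p : G -> R * R).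
Implicit Types (a b w : G) (z m : R * R).

(* Applied to the parameters of the planarization vertices on an edge, this gives
   the end of the sub-segment around [x]. *)
Lemma last_before (F : set R) (x : R) : closed F -> F 0 -> 0 <= x -> ~ F x ->
  exists y : R, [/\ 0 <= y, y < x, F y & forall t : R, y < t -> t <= x -> ~ F t].
Proof.
move=> cF F0 x0 nFx; pose A := F `&` `[0, x].
have cA : closed A by apply: closedI => //; exact: interval_closed.
have A0 : A 0 by split => //=; rewrite in_itv /= lexx.
have ubA : has_ubound A by exists x => t [_ /=]; rewrite in_itv => /andP[].
have := @closure_sup R A (ex_intro _ _ A0) ubA.
rewrite -(proj1 (@closure_id _ A) cA) => -[Fs].
rewrite /= in_itv /= => /andP[s0 sx].
exists (sup A); split => //.
  by rewrite lt_neqAle sx andbT; apply/eqP => e; apply: nFx; rewrite -e.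
move=> t st tx Ft; have : t <= sup A.
  by apply: ub_le_sup => //; split => //=; rewrite in_itv /= tx (le_trans s0 (ltW st)).
by rewrite leNgt st.
Qed.

Lemma conv_gt (r x y c : R) : 0 <= r -> r <= 1 -> c < x -> c < y ->
  c < (1 - r) * x + r * y.
Proof.
(* Strictness must come from a positive weight, and one of the two weights is at least 1/2. *)
move=> r0 r1 cx cy; case: (lerP r (1 / 2)) => rh.
  have : 0 < (1 - r) * (x - c) by apply: mulr_gt0; lra.
  have : 0 <= r * (y - c) by apply: mulr_ge0; lra.
  lra.
have : 0 <= (1 - r) * (x - c) by apply: mulr_ge0; lra.
have : 0 < r * (y - c) by apply: mulr_gt0; lra.
lra.
Qed.

Lemma conv_lt (r x y c : R) : 0 <= r -> r <= 1 -> x < c -> y < c ->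
  (1 - r) * x + r * y < c.
Proof.
move=> r0 r1 xc yc; have := @conv_gt r (- x) (- y) (- c) r0 r1; rewrite !ltrN2.
by move=> /(_ xc yc); lra.
Qed.

Lemma vertex_outer w z : escapes (drawing_set p) z ->
  clear (drawing_set p) (p w) z -> vertex_on_outer_face p w.
Proof.
move=> zD wz; apply: boundary_outer; first by left; exists w.
apply: closure_approx => e e0.
pose t := Num.min 1 (e / (`|z - p w| + 1)).
have n0 : 0 < `|z - p w| + 1 by rewrite ltr_wpDl.
have t0 : 0 < t by rewrite lt_min ltr01 divr_gt0.
have t1 : t <= 1 by rewrite ge_min lexx.
exists (pt (p w) z t).
  by apply: escapes_outer; apply: escapes_clear => //; exact: drawing_compact.
have -> : p w - pt (p w) z t = - t *: (z - p w).
  by apply: pair_eq; rewrite !coordE; ring.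
rewrite normrZ normrN gtr0_norm //.
have : t * (`|z - p w| + 1) <= e by rewrite -ler_pdivlMr // ge_min lexx orbT.
by lra.
Qed.

(** A single accessible point [m] is enough: the sub-segment around [m] meets no other edge in its
    interior, so an outer point near [m] can slide along it, parallel to [ab]. *)
Lemma reducible_edge a b m z : adj a b -> p a != p b ->
  segment (p a) (p b) m -> ~ other_edges p a b m ->
  clear (drawing_set p) m z -> escapes (drawing_set p) z ->
  orient (p a) (p b) z != 0 ->
  exists c d : R * R, planarization_edge p a b c d /\
    segment c d `<=` boundary (outer_face p).
Proof.
move=> ab pab /segmentP[x [x0 x1 ->]] nOx mz zD crz.
set O := other_edges p a b in nOx *.
have cO : closed O.
  by apply: compact_closed; [exact: norm_hausdorff|exact: edges_set_compact].
have cF q r : closed (pt q r @^-1` O).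
  by apply: closed_comp => // t _; exact: pt_continuous.
have O_a : O (p a) by left; exists a.
have O_b : O (p b) by left; exists b.
have [] := @last_before _ x (cF (p a) (p b)) _ x0 nOx; first by rewrite /= pt_0.
move=> s [s0 sx Os ns].
(* The same search from the other end, with parameters counted from [b]. *)
have [||| y [y0 yx Oy ny]] := @last_before _ (1 - x) (cF (p b) (p a)).
- by rewrite /= pt_0.
- by lra.
- by rewrite /= pt_sym subKr.
pose t : R := 1 - y.
have nO u : s < u -> u < t -> ~ O (pt (p a) (p b) u).
  move=> su ut; case: (leP u x) => ux; first exact: ns.
  by rewrite pt_sym; apply: ny; rewrite /t in ut; lra.
have st : s < t by rewrite /t; lra.
have t1 : t <= 1 by rewrite /t; lra.
have Ot : O (pt (p a) (p b) t) by rewrite pt_sym /t subKr.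
have inj_pt u v : pt (p a) (p b) u = pt (p a) (p b) v -> u = v.
  move=> e; have := congr1 fst e; have := congr1 snd e; rewrite !coordE => e2 e1.
  apply/eqP; rewrite -subr_eq0; apply/eqP; apply: contraNeq (pab) => uv.
  apply/eqP/pair_eq; apply: (mulfI uv); lra.
have innerE u : s <= u -> u <= t -> segment (p a) (p b) (pt (p a) (p b) u).
  by move=> su ut; apply: segment_pt; lra.
exists (pt (p a) (p b) s), (pt (p a) (p b) t); split.
  have PV := planarization_vertexP ab.
  split; first by apply/eqP => /inj_pt; lra.
  - by split; [|apply/PV]; rewrite //; apply: innerE; lra.
  - by split; [|apply/PV]; rewrite //; apply: innerE; lra.
  - move=> _ /segmentP[u [u0 u1 ->]]; rewrite pt_pt.
    set u' := (1 - u) * s + u * t => /PV Ou.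
    have su : s <= u' by rewrite /u'; nra.
    have ut : u' <= t by rewrite /u'; nra.
    have {}Ou := Ou (innerE _ su ut).
    case: (ltgtP s u') su => // [su _|-> _]; last by left.
    case: (ltgtP u' t) ut => // [ut _|-> _]; last by right.
    by case: (nO _ su ut).
(* A translate of the sub-segment towards [z] avoids the drawing. *)
have open_part u : s < u -> u < t -> closure (outer_face p) (pt (p a) (p b) u).
  move=> su ut; apply: closure_approx => e e0.
  have [|e' e'0 He'] := pos_dist (@segment_compact2 _ (pt (p a) (p b) x) (pt (p a) (p b) u))
      (@edges_set_compact _ _ p [rel x y | [&& adj x y, (x, y) != (a, b) & (x, y) != (b, a)]]).
    rewrite -subset0 => _ [/segmentP[r [r0 r1 ->]]]; rewrite pt_pt.
    by apply: nO; [exact: conv_gt|apply: conv_lt; rewrite // /t; lra].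
  set k := z - pt (p a) (p b) x.
  pose d := Num.min 1 (Num.min (e / (`|k| + 1)) (e' / (`|k| + 1))).
  have n0 : 0 < `|k| + 1 by rewrite ltr_wpDl.
  have d0 : 0 < d by rewrite !lt_min ltr01 !divr_gt0.
  have d1 : d <= 1 by rewrite ge_min lexx.
  have nd1 : d * (`|k| + 1) <= e by rewrite -ler_pdivlMr // !ge_min lexx !orbT.
  have nd2 : d * (`|k| + 1) <= e' by rewrite -ler_pdivlMr // !ge_min lexx !orbT.
  have nk : `|d *: k| = d * `|k| by rewrite normrZ gtr0_norm.
  exists (pt (p a) (p b) u + d *: k); last first.
    by rewrite opprD addNKr normrN nk; lra.
  apply: escapes_outer.
  have xd : escapes (drawing_set p) (pt (p a) (p b) x + d *: k).
    have -> : pt (p a) (p b) x + d *: k = pt (pt (p a) (p b) x) z d.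
      by apply: pair_eq; rewrite !coordE; ring.
    exact: (escapes_clear (@drawing_compact _ _ p) mz zD d0 d1).
  apply: (escapes_step (@drawing_compact _ _ p) _ xd) => _ /segmentP[r [r0 r1 ->]].
  have -> : pt (pt (p a) (p b) x + d *: k) (pt (p a) (p b) u + d *: k) r =
      pt (pt (p a) (p b) x) (pt (p a) (p b) u) r + d *: k.
    by apply: pair_eq; rewrite !coordE; ring.
  (* The gap [e'] keeps the translate off the other edges; it misses [ab] because [orient] is [d]
     times its nonzero value at [z]. *)
  move=> /(drawing_other p _ ab)[Or|/orient_segment].
    have := He' _ _ (segment_pt (pt (p a) (p b) x) (pt (p a) (p b) u) r0 r1) Or.
    by rewrite opprD addNKr normrN nk; lra.
  rewrite pt_pt => c0.
  have : d * orient (p a) (p b) z = 0.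
    by rewrite -c0 /k /orient !coordE; ring.
  by move/eqP; rewrite mulf_eq0 (negbTE crz) gt_eqF.
move=> _ /segmentP[u [u0 u1 ->]]; rewrite pt_pt.
set u' : R := (1 - u) * s + u * t.
apply: boundary_outer.
  by apply/(drawing_other p _ ab); right; apply: innerE; rewrite /u'; nra.
(* The ends of the sub-segment are limits of inner points, so parameters are nudged by a factor [h]
   towards the midpoint. *)
have closedC : closed (pt (p a) (p b) @^-1` closure (outer_face p)).
  by apply: closed_comp => [t0 _|]; [exact: pt_continuous|exact: closed_closure].
apply: closedC => V /nbhs_ballP[e /= e0 uV].
pose h : R := Num.min (1/2) (e / (2 * (t - s))).
pose q : R := (1 - h) * u' + h * ((s + t) / 2).
have ts : 0 < 2 * (t - s) by lra.
have h0 : 0 < h by rewrite lt_min; apply/andP; split; [lra|exact: divr_gt0].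
have h1 : h <= 1 / 2 by rewrite ge_min lexx.
have he : h * (2 * (t - s)) <= e by rewrite -ler_pdivlMr // ge_min lexx orbT.
have su : s <= u' by rewrite /u'; nra.
have ut : u' <= t by rewrite /u'; nra.
exists q; split.
  have k1 : 0 <= (1 - h) * (u' - s) by apply: mulr_ge0; lra.
  have k2 : 0 <= (1 - h) * (t - u') by apply: mulr_ge0; lra.
  have k3 : 0 < h * (t - s) by apply: mulr_gt0; lra.
  by apply: open_part; rewrite /q; lra.
apply: uV; rewrite /ball /=.
have -> : u' - q = h * (u' - (s + t) / 2) by rewrite /q; ring.
rewrite normrM gtr0_norm //.
have : `|u' - (s + t) / 2| <= t - s by rewrite ler_norml; apply/andP; split; lra.
have : 0 <= `|u' - (s + t) / 2| by [].
nra.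
Qed.

End Conclusions.

(** * Directions and thin cones *)

Section Directions.
Variable R : realType.
Local Notation P := (R * R)%type.
Implicit Types (e f g v w : P) (k t s : R).

Definition det e f : R := e.1 * f.2 - e.2 * f.1.
Definition dot e f : R := e.1 * f.1 + e.2 * f.2.

(* [e] and [f] do not span the same ray, in a form that is visibly an open
   condition on both. *)
Definition diverge e f : Prop := det e f != 0 \/ dot e f < 0.

Lemma dot_gt0 e : e != 0 -> 0 < dot e e.
Proof.
move=> e0; rewrite lt_def /dot -!expr2 addr_ge0 ?sqr_ge0 // andbT.
rewrite paddr_eq0 ?sqr_ge0 // !sqrf_eq0; apply: contra e0 => /andP[/eqP e1 /eqP e2].
by apply/eqP/pair_eq.
Qed.

Lemma divergeC e f : diverge e f -> diverge f e.
Proof.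
rewrite /diverge; have -> : det f e = - det e f by rewrite /det; ring.
have -> : dot f e = dot e f by rewrite /dot; ring.
by rewrite oppr_eq0.
Qed.

(** Equality would give [s * det e f = 0] and [s * dot e f = t * dot e e > 0], contradicting either
    case of [diverge]. *)
Lemma diverge_neq e f t s : diverge e f -> 0 < t -> 0 <= s -> t *: e <> s *: f.
Proof.
move=> ef t0 s0 eq; have := congr1 fst eq; have := congr1 snd eq.
rewrite !coordE => h2 h1.
have d0 : s * det e f = 0.
  have : t * (s * det e f) = 0.
    transitivity ((t * e.1) * (s * f.2) - (t * e.2) * (s * f.1)).
      by rewrite /det; ring.
    by rewrite h1 h2; ring.
  by move/eqP; rewrite mulf_eq0 gt_eqF //= => /eqP.
have e_neq0 : e != 0.
  apply/eqP => e0; move: ef; rewrite /diverge /det /dot e0 /=.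
  by rewrite !mul0r subrr addr0 eqxx ltxx => -[].
have dd : s * dot e f = t * dot e e.
  transitivity (e.1 * (s * f.1) + e.2 * (s * f.2)); first by rewrite /dot; ring.
  by rewrite -h1 -h2 /dot; ring.
have := mulr_gt0 t0 (dot_gt0 e_neq0); rewrite -dd.
case: ef => [det0|dot0]; last by nra.
by move/eqP: d0; rewrite mulf_eq0 (negbTE det0) orbF => /eqP ->; rewrite mul0r ltxx.
Qed.

Lemma diverge_scale e f k : 0 < k -> diverge e f -> diverge (k *: e) f.
Proof.
move=> k0; rewrite /diverge.
have -> : det (k *: e) f = k * det e f by rewrite /det !coordE; ring.
have -> : dot (k *: e) f = k * dot e f by rewrite /dot !coordE; ring.
by case=> [d|d]; [left; rewrite mulf_neq0 // gt_eqF|right; rewrite pmulr_rlt0].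
Qed.

Lemma divergeNN e f : diverge e f -> diverge (- e) (- f).
Proof.
rewrite /diverge.
have -> : det (- e) (- f) = det e f by rewrite /det !coordE; ring.
by have -> : dot (- e) (- f) = dot e f by rewrite /dot !coordE; ring.
Qed.

Lemma not_diverge e f : e != 0 -> f != 0 -> ~ diverge e f ->
  exists2 k, 0 < k & e = k *: f.
Proof.
move=> e0 f0 /not_orP[/negP/negPn/eqP d0 /negP]; rewrite -leNgt => dot0.
have ff := dot_gt0 f0.
(* For parallel vectors the factor is that of the orthogonal projection onto [f]. *)
have ef : e = (dot e f / dot f f) *: f.
  have ne := negbT (gt_eqF ff); have h : e.1 * f.2 = e.2 * f.1.
    by apply/eqP; rewrite -subr_eq0 -/(det e f) d0.
  apply: pair_eq; rewrite !coordE; apply: (mulIf ne);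
    rewrite mulrAC mulfVK // /dot.
    transitivity (e.1 * f.1 * f.1 + (e.1 * f.2) * f.2); first by ring.
    by rewrite h; ring.
  transitivity ((e.2 * f.1) * f.1 + e.2 * f.2 * f.2); first by ring.
  by rewrite -h; ring.
exists (dot e f / dot f f) => //.
rewrite divr_gt0 // lt_def dot0 andbT; apply: contra e0 => /eqP d1.
by rewrite ef d1 mul0r scale0r.
Qed.

Lemma near_small (K c : R) : 0 < c -> \forall s \near (0 : R)^'+, s * K < c.
Proof.
move=> c0; near=> s.
have s0 : 0 < s by near: s; exact: nbhs_right_gt.
have K0 : 0 < `|K| + 1 by rewrite ltr_wpDl.
have : s < c / (`|K| + 1) by near: s; apply: nbhs_right_lt; rewrite divr_gt0.
rewrite ltr_pdivlMr // => h; apply: le_lt_trans h; apply: ler_wpM2l; first exact: ltW.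
by have := ler_norm K; lra.
Unshelve. all: by end_near. Qed.

Lemma diverge_near e f g : diverge e f ->
  \forall s \near (0 : R)^'+, forall k, `|k| <= s -> diverge e (f + k *: g).
Proof.
have detD k : det e (f + k *: g) = det e f + k * det e g.
  by rewrite /det !coordE; ring.
have dotD k : dot e (f + k *: g) = dot e f + k * dot e g.
  by rewrite /dot !coordE; ring.
case=> [d0|d0]; near=> s => k ks.
  left; rewrite detD; apply: contraTN isT => /eqP eq.
  have : s * `|det e g| < `|det e f|.
    by near: s; apply: near_small; rewrite normr_gt0.
  have -> : det e f = - (k * det e g) by lra.
  by rewrite normrN normrM ltNge ler_wpM2r.
right; rewrite dotD.
have : s * `|dot e g| < - dot e f by near: s; apply: near_small; lra.
have : k * dot e g <= s * `|dot e g|.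
  by rewrite (le_trans (ler_norm _)) // normrM ler_wpM2r.
lra.
Unshelve. all: by end_near. Qed.

Lemma cone_far (B : set P) v f g : compact B -> ~ B v ->
  \forall s \near (0 : R)^'+, forall t k, 0 < t -> t < s -> `|k| < s ->
    ~ B (v + t *: (f + k *: g)).
Proof.
move=> cB nBv; have [|e e0 He] := pos_dist (@compact_set1 _ v) cB.
  by rewrite -subset0 => _ [-> ].
near=> s => t k t0 ts ks Bs.
have := He _ _ (erefl v) Bs.
rewrite opprD addNKr normrN normrZ gtr0_norm //.
have s0 : 0 < s by apply: lt_trans ts.
have s1 : s < 1 by near: s; exact: nbhs_right_lt.
have : s * (`|f| + `|g|) < e by near: s; exact: near_small.
have : `|f + k *: g| <= `|f| + `|g|.
  apply: (le_trans (ler_normD _ _)); rewrite lerD2l normrZ.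
  by rewrite -[leRHS]mul1r ler_wpM2r // ltW // (lt_trans ks).
have : 0 <= `|f + k *: g| by [].
have : 0 <= `|f| + `|g| by rewrite addr_ge0.
nra.
Unshelve. all: by end_near. Qed.

(** The edge touches the apex, so distance is of no help; its direction stays apart from every
    direction of a thin cone, at all lengths. *)
Lemma cone_edge v w f g : diverge f (w - v) ->
  \forall s \near (0 : R)^'+, forall t k, 0 < t -> `|k| < s ->
    ~ segment v w (v + t *: (f + k *: g)).
Proof.
move=> /divergeC /(diverge_near g) fw; near=> s => t k t0 ks /segmentP[l [l0 l1 eq]].
have /divergeC fkw : diverge (w - v) (f + k *: g).
  by have := ltW ks; move: k {ks eq}; near: s.
apply: (diverge_neq fkw t0 l0); apply: (addrI v); rewrite eq.
by apply: pair_eq; rewrite !coordE; ring.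
Unshelve. all: by end_near. Qed.

(** On a common ray, an initial piece of the clear segment would run along [vw]. *)
Lemma clear_diverge (D : set P) v e w : e != 0 -> w != v ->
  clear D v (v + e) -> segment v w `<=` D -> diverge e (w - v).
Proof.
move=> e0 wv cl vw; apply: contrapT => /(not_diverge e0); rewrite subr_eq0.
move=> /(_ wv)[k k0 eq].
pose t := Num.min 1 k^-1.
have t0 : 0 < t by rewrite lt_min ltr01 invr_gt0.
have t1 : t <= 1 by rewrite ge_min lexx.
have tk : t * k <= 1 by rewrite -ler_pdivlMr // div1r ge_min lexx orbT.
apply: (cl t t0 t1); apply: vw.
have -> : pt v (v + e) t = pt v w (t * k).
  by rewrite eq; apply: pair_eq; rewrite !coordE; ring.
by apply: segment_pt => //; rewrite mulr_ge0 // ltW.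
Qed.

Lemma segment_diverge v a b : a != v -> b != v ->
  ~ segment v a b -> ~ segment v b a -> diverge (a - v) (b - v).
Proof.
move=> av bv nab nba; apply: contrapT => /not_diverge.
rewrite !subr_eq0 => /(_ av bv)[k k0 eq].
case: (lerP k 1) => k1.
  apply: nba; have -> : a = pt v b k.
    by rewrite -[LHS](subrK v) eq; apply: pair_eq; rewrite !coordE; ring.
  by apply: segment_pt => //; exact: ltW.
apply: nab; have -> : b = pt v a k^-1.
  have e2 : b - v = k^-1 *: (a - v) by rewrite eq scalerA mulVf ?gt_eqF // scale1r.
  by rewrite -[LHS](subrK v) e2; apply: pair_eq; rewrite !coordE; ring.
by apply: segment_pt; [rewrite invr_ge0 ltW|rewrite invf_le1 // ltW].
Qed.

Lemma diverge_det e f : diverge e f -> diverge e (- f) -> det e f != 0.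
Proof.
rewrite {2}/diverge; have -> : det e (- f) = - det e f.
  by rewrite /det !coordE; ring.
have -> : dot e (- f) = - dot e f by rewrite /dot !coordE; ring.
rewrite oppr_eq0 => -[//|d1] [//|d2]; lra.
Qed.

(** As [x] tends to [v], the segment [ux] tends to [uv] and [vx] shrinks to [v], a point of [uv]. *)
Lemma segment_move (A : set P) u v : compact A -> A `&` segment u v = set0 ->
  exists2 e : R, 0 < e & forall x, `|x - v| < e ->
    A `&` (segment u x `|` segment v x) = set0.
Proof.
move=> cA Auv; have [e e0 He] := pos_dist cA (@segment_compact2 _ u v) Auv.
exists e => // x xv; rewrite -subset0 => y [Ay]; case=> /segmentP[t [t0 t1 yE]].
  have := He y _ Ay (segment_pt u v t0 t1); rewrite leNgt => /negP; apply.
  rewrite yE; apply: le_lt_trans (norm_pt_sub _ _ _ _ t0 t1) _.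
  by rewrite subrr normr0 max_r.
have := He y _ Ay (segment_r u v); rewrite leNgt => /negP; apply.
by rewrite yE; apply: le_lt_trans (norm_pt_l _ _ t0 t1) _.
Qed.

End Directions.

(** * The invariant *)

Section Invariant.
Variables (R : realType) (G : sgraph) (p : G -> R * R) (L : rel G).
Implicit Types a b c w : G.
Local Notation D := (drawing_set p).

(* Invariant (2): [m] is a point of the edge [ab] and of no other edge, and the
   half-open segment from [m] to [z] runs in the outer face. *)
Definition visible a b := exists m z : R * R,
  [/\ segment (p a) (p b) m /\ ~ other_edges p a b m, clear D m z, escapes D z,
      orient (p a) (p b) z != 0
    & forall c, adj a c -> adj b c ->
        orient (p a) (p b) (p c) * orient (p a) (p b) z < 0].

(** Clearness near [b] also keeps every edge at [b] from leaving in the direction [p b - p a]; this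
    is what makes room for a cone there. *)
Definition slot a b := exists k : R,
  [/\ 0 < k, clear D (p b) (p b + k *: (p b - p a))
    & escapes D (p b + k *: (p b - p a))].

(* [L a b] means that [b] is the later endpoint of the edge [ab]; the initial
   edge is oriented both ways. *)
Record growable : Prop := Growable {
  grow_inj : injective p;
  grow_edge : forall a b w, adj a b -> segment (p a) (p b) (p w) -> w = a \/ w = b;
  grow_nonedge : forall a b, a != b -> ~~ adj a b ->
    exists2 z, segment (p a) (p b) z & escapes D z;
  grow_visible : forall a b, adj a b -> visible a b;
  grow_slot : forall a b, L a b -> slot a b;
  grow_sub : forall a b, L a b -> adj a b;
  grow_cover : forall a b, adj a b -> L a b || L b a;
  grow_vertex : forall b, exists a, L a b;
  grow_triangle : forall a b c, L a b -> L c b -> a != c -> adj a c }.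

Lemma visibleC a b : visible a b -> visible b a.
Proof.
have crC (c : R * R) : orient (p b) (p a) c = - orient (p a) (p b) c by rewrite /orient; ring.
move=> [m [z [[abm nm] mz zD crz hc]]]; exists m, z; split => //.
- by split; [rewrite segmentC|rewrite other_edgesC].
- by rewrite crC oppr_eq0.
- by move=> c bc ac; rewrite !crC mulrNN; exact: hc.
Qed.

Lemma adj_neq a b : adj a b -> a != b.
Proof. by move=> ab; apply/eqP => e; move: ab; rewrite e adj_irrefl. Qed.

Lemma growable_OOR : growable ->
  [/\ is_OOR p, is_reducible p & forall w, vertex_on_outer_face p w].
Proof.
move=> gr; split.
- split; [exact: grow_inj gr|exact: grow_edge gr|].
  move=> a b ab nab; have [z abz /escapes_outer zo] := grow_nonedge gr ab nab.
  by exists z.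
- move=> a b ab; have [m [z [[abm nm] mz zD crz _]]] := grow_visible gr ab.
  apply: (reducible_edge ab _ abm nm mz zD crz).
  by apply: contra (adj_neq ab) => /eqP /(grow_inj gr) ->.
- move=> w; have [a /(grow_slot gr)[k [_ cl zD]]] := grow_vertex gr w.
  exact: vertex_outer zD cl.
Qed.

Lemma edge_drawing a b : adj a b -> segment (p a) (p b) `<=` D.
Proof. by move=> ab z abz; right; exists a, b. Qed.

Lemma vertex_drawing a : D (p a).
Proof. by left; exists a. Qed.

(** Otherwise the shorter of the two edges would end inside the longer one, against [grow_edge]. *)
Lemma growable_diverge a b v : growable -> adj v a -> adj v b -> a != b ->
  diverge (p a - p v) (p b - p v).
Proof.
move=> gr va vb ab; have vE w w' : adj w w' -> p w' != p w.
  by move=> /adj_neq; apply: contra => /eqP/(grow_inj gr)->.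
apply: segment_diverge; rewrite ?vE // => /(grow_edge gr) [] // /eqP.
- by rewrite eq_sym (negbTE (adj_neq vb)).
- by rewrite eq_sym (negbTE ab).
- by rewrite eq_sym (negbTE (adj_neq va)).
- by rewrite (negbTE ab).
Qed.

End Invariant.

(** * The drawing after adding a vertex at an arbitrary point near [v] *)

Section Extension.
Variables (R : realType) (H : sgraph) (p : H -> R * R) (L : rel H) (u v : H).
Implicit Types (a b c w : H) (x y z m : R * R).
Hypothesis uv : adj u v.
Local Notation D := (drawing_set p).

Definition place x (o : extend u v) : R * R := if o is Some a then p a else x.

Definition later (o o' : extend u v) : bool :=
  match o, o' with
  | Some a, Some b => L a b
  | Some a, None => (a == u) || (a == v)
  | None, _ => false
  end.

Definition new_edges x := segment (p u) x `|` segment (p v) x.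

Lemma drawing_place x : drawing_set (place x) = D `|` new_edges x.
Proof.
apply/seteqP; split => y.
  case=> [[[a|] _ <-]|[[a|] [[b|] /= [ab abz]]]] //.
  - by left; left; exists a.
  - by right; left; exact: segment_r.
  - by left; right; exists a, b.
  - by case/orP: ab abz => /eqP -> abz; right; [left|right].
  - rewrite segmentC in abz.
    by case/orP: ab abz => /eqP -> abz; right; [left|right].
case=> [[[a _ <-]|[a [b [ab abz]]]]|[uxy|vxy]].
- by left; exists (Some a).
- by right; exists (Some a), (Some b).
- by right; exists (Some u), None; rewrite /= eqxx.
- by right; exists (Some v), None; rewrite /= eqxx orbT.
Qed.

Lemma other_place_old x a b y : other_edges (place x) (Some a) (Some b) y ->
  other_edges p a b y \/ new_edges x y.
Proof.
move=> /other_edgesP[[[c|] _ <-]|[[c|] [[d|] [cd n1 n2 cdy]]]] //.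
- by left; left; exists c.
- by right; left; exact: segment_r.
- by left; apply/other_edgesP; right; exists c, d.
- by case/orP: cd cdy => /eqP -> cdy; right; [left|right].
- rewrite segmentC in cdy.
  by case/orP: cd cdy => /eqP -> cdy; right; [left|right].
Qed.

Lemma other_place_u x y : other_edges (place x) (Some u) None y ->
  D y \/ segment (p v) x y.
Proof.
move=> /other_edgesP[[[c|] _ <-]|[[c|] [[d|] [cd n1 n2 cdy]]]] //.
- by left; left; exists c.
- by right; exact: segment_r.
- by left; right; exists c, d.
- by case/orP: cd => /eqP e; [rewrite e eqxx in n1|rewrite -e; right].
- rewrite segmentC in cdy.
  by case/orP: cd => /eqP e; [rewrite e eqxx in n2|rewrite -e; right].
Qed.

Lemma other_place_v x y : other_edges (place x) (Some v) None y ->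
  D y \/ segment (p u) x y.
Proof.
move=> /other_edgesP[[[c|] _ <-]|[[c|] [[d|] [cd n1 n2 cdy]]]] //.
- by left; left; exists c.
- by right; exact: segment_r.
- by left; right; exists c, d.
- by case/orP: cd => /eqP e; [rewrite -e; right|rewrite e eqxx in n1].
- rewrite segmentC in cdy.
  by case/orP: cd => /eqP e; [rewrite -e; right|rewrite e eqxx in n2].
Qed.

Lemma drawing_place_near x y : drawing_set (place x) y ->
  exists2 d, D d & `|y - d| <= `|x - p v|.
Proof.
rewrite drawing_place; case=> [Dy|[] /segmentP[t [t0 t1 ->]]].
- by exists y => //; rewrite subrr normr0.
- exists (pt (p u) (p v) t).
    by apply: (edge_drawing uv); exact: segment_pt.
  by apply: le_trans (norm_pt_sub _ _ _ _ t0 t1) _; rewrite subrr normr0 max_r.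
- by exists (p v); [exact: vertex_drawing|exact: norm_pt_l].
Qed.

Lemma escapes_place z : escapes D z -> exists2 e : R, 0 < e &
  forall x z', `|x - p v| < e -> `|z' - z| < e -> escapes (drawing_set (place x)) z'.
Proof.
move=> /escapes_near[e e0 He]; exists e => // x z' xv zz'.
apply: He => // d' /drawing_place_near[d Dd dd']; exists d => //.
exact: le_lt_trans xv.
Qed.

(** As [m] is off [uv], the whole closed segment from [m] to [z] misses [uv], and compactness gives
    a margin. *)
Lemma clear_place m z : ~ segment (p u) (p v) m -> clear D m z ->
  exists2 e : R, 0 < e & forall x, `|x - p v| < e ->
    clear (drawing_set (place x)) m z /\ ~ new_edges x m.
Proof.
move=> uvm mz.
have [|e e0 He] := segment_move (@segment_compact2 _ m z)
  (_ : _ `&` segment (p u) (p v) = set0).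
  rewrite -subset0 => y [/segmentP[t [t0 t1 ->]] uvy].
  move: t0 uvy; rewrite le_eqVlt => /orP[/eqP <-|t0]; first by rewrite pt_0.
  by move=> /(edge_drawing uv); exact: mz.
exists e => // x /He; rewrite -subset0 => mzN; split.
  move=> t t0 t1; rewrite drawing_place => -[|Nt]; first exact: mz.
  by apply: (mzN (pt m z t)); split => //; apply: segment_pt => //; exact: ltW.
by move=> Nm; apply: (mzN m); split => //; exact: segment_l.
Qed.

End Extension.

(** * Stacking a vertex *)

Section Stub.
(* Coordinates, in the chart below, of the point at parameter [s ^ 2] on the
   segment from the new vertex to the vertex with coordinates [(al, be)]. *)
Variables (R : realType) (s k al be : R).
Local Notation t := (s + s * s * (al - s)).
Local Notation r := ((1 + be - s * s) * (s * s)).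

Lemma stub_cone : 0 < s -> s < 1 -> 8 * s < k -> s * (`|al| + 1) < 1 / 2 ->
  s * (2 * (2 + `|be|)) < k -> [/\ s / 2 <= t, t < k & `|1 + be - s * s| * (2 * s) < k].
Proof.
move=> s0 s1 sk sal sbe; have sala : `|s * al| = s * `|al| by rewrite normrM gtr0_norm.
have /andP[sa1 sa2] : - (s * `|al|) <= s * al <= s * `|al| by rewrite -ler_norml sala.
have ss1 : s * s < s by rewrite -[ltRHS]mul1r ltr_pM2r.
have ss0 : 0 < s * s by rewrite mulr_gt0.
have low : 0 < s * (s * al - s * s + 1 / 2) by apply: mulr_gt0 => //; lra.
have up : 0 < s * (1 / 2 - (s * al - s * s)) by apply: mulr_gt0 => //; lra.
split; [lra|lra|].
have /andP[be1 be2] : - `|be| <= be <= `|be| by rewrite -ler_norml.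
have : `|1 + be - s * s| <= 2 + `|be| by rewrite ler_norml; apply/andP; split; lra.
by rewrite -(ler_pM2r s0); lra.
Qed.

(** Divided by [s * s], the claim is [be < s * al]. *)
Lemma stub_left : 0 < s -> be < 0 -> s * (1 + `|al|) < `|be| -> r < s * t.
Proof.
move=> s0 b0; rewrite (ltr0_norm b0) => sab.
have := ler_norm (- (s * al)); rewrite normrN normrM gtr0_norm // => low.
have : 0 < s * s * (s * al - be) by rewrite !mulr_gt0 //; lra.
by lra.
Qed.

(** Divided by [s * s], the claim is [s * s * (1 + al) < be * (1 + s)]. *)
Lemma stub_right : 0 < s -> s < 1 -> 0 < be -> s * (1 + `|al|) < `|be| ->
  s * s * (1 + t) < r * (1 + s).
Proof.
move=> s0 s1 b0; rewrite (gtr0_norm b0) => sab.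
have ss1 : s * s < s by rewrite -[ltRHS]mul1r ltr_pM2r.
have sal : s * (s * al) <= s * `|al|.
  rewrite ler_pM2l //; apply: le_trans (ler_norm _) _; rewrite normrM gtr0_norm //.
  by rewrite -[leRHS]mul1r ler_wpM2r // ltW.
have bs : 0 < be * s by rewrite mulr_gt0.
have : 0 < s * s * (be * (1 + s) - s * s - s * (s * al)).
  by rewrite mulr_gt0 ?mulr_gt0 //; lra.
by lra.
Qed.

End Stub.

Section Step.
Variables (R : realType) (H : sgraph) (p : H -> R * R) (L : rel H) (u v : H).
Local Notation P := (R * R)%type.
Local Notation D := (drawing_set p).
Hypotheses (gr : growable p L) (Luv : L u v).

Let uv : adj u v := grow_sub gr Luv.
Variable f : P.
Hypothesis fE : f = p v - p u.

Variables (m0 z0 g : P).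
Hypotheses (m0_uv : segment (p u) (p v) m0) (m0_other : ~ other_edges p u v m0)
  (m0_clear : clear D m0 z0) (z0_escapes : escapes D z0)
  (z0_side : forall c, adj u c -> adj v c ->
     orient (p u) (p v) (p c) * orient (p u) (p v) z0 < 0)
  (g_side : det f g * orient (p u) (p v) z0 < 0).

(** Affine coordinates in which [u], [v] and the new vertex are [(-1, 0)], [(0, 0)] and
    [(s, s^2)]. *)
Definition chart (t r : R) : P := p v + t *: f + r *: g.

Variable k : R.
(** A convex region free of the old drawing: inside it, only the two new edges can obstruct. *)
Definition cone (t r : R) : Prop := [/\ 0 < t, t < k & `|r| < k * t].
Hypotheses (k_gt0 : 0 < k) (cone_D : forall t r, cone t r -> ~ D (chart t r))
  (chart_escapes : escapes D (chart (k / 2) 0)).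

Let det_fg : det f g != 0.
Proof. by apply: contraTneq g_side => ->; rewrite mul0r ltxx. Qed.

Lemma chart_pt t r t' r' l : pt (chart t r) (chart t' r') l =
  chart ((1 - l) * t + l * t') ((1 - l) * r + l * r').
Proof. by apply: pair_eq; rewrite !coordE; ring. Qed.

Lemma chart_u : chart (-1) 0 = p u.
Proof. by rewrite /chart fE; apply: pair_eq; rewrite !coordE; ring. Qed.

Lemma chart_v : chart 0 0 = p v.
Proof. by apply: pair_eq; rewrite !coordE; ring. Qed.

Lemma chart_inj t r t' r' : chart t r = chart t' r' -> t = t' /\ r = r'.
Proof.
move=> e; have e1 := congr1 fst e; have e2 := congr1 snd e.
rewrite !coordE in e1 e2.
split; apply: (mulIf det_fg); rewrite /det.
  transitivity ((t * f.1) * g.2 - (t * f.2) * g.1); first by ring.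
  have -> : t * f.1 = t' * f.1 + r' * g.1 - r * g.1 by lra.
  have -> : t * f.2 = t' * f.2 + r' * g.2 - r * g.2 by lra.
  by ring.
transitivity (f.1 * (r * g.2) - f.2 * (r * g.1)); first by ring.
have -> : r * g.1 = t' * f.1 + r' * g.1 - t * f.1 by lra.
have -> : r * g.2 = t' * f.2 + r' * g.2 - t * f.2 by lra.
by ring.
Qed.

Lemma orient_chart t r : orient (p u) (p v) (chart t r) = r * det f g.
Proof. by rewrite /orient /det /chart fE !coordE; ring. Qed.

Lemma cone_pt t r t' r' l : 0 <= l -> l <= 1 -> cone t r -> cone t' r' ->
  cone ((1 - l) * t + l * t') ((1 - l) * r + l * r').
Proof.
move=> l0 l1 [t0 tk rk] [t'0 t'k r'k]; split.
- exact: conv_gt.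
- exact: conv_lt.
- have l1' : 0 <= 1 - l by rewrite subr_ge0.
  apply: (le_lt_trans (ler_normD _ _)); rewrite !normrM (ger0_norm l0) (ger0_norm l1').
  have -> : k * ((1 - l) * t + l * t') = k * t + l * (k * t' - k * t) by ring.
  have : (1 - l) * (`|r| - k * t) + l * (`|r'| - k * t') < 0.
    by apply: conv_lt; rewrite // subr_lt0.
  by lra.
Qed.

Definition newpt (s : R) : P := chart s (s * s).
Local Notation q s := (@place R H p u v (newpt s)).
Local Notation D' s := (drawing_set (q s)).

Lemma pt_u s l : pt (p u) (newpt s) l = chart (l * (1 + s) - 1) (l * (s * s)).
Proof. by rewrite -chart_u chart_pt; congr chart; ring. Qed.

Lemma pt_v s l : pt (p v) (newpt s) l = chart (l * s) (l * (s * s)).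
Proof. by rewrite -chart_v chart_pt; congr chart; ring. Qed.

Lemma det_sqr_gt0 : 0 < det f g * det f g.
Proof. by rewrite -expr2 lt_def sqrf_eq0 det_fg sqr_ge0. Qed.

Lemma new_edges_side s y : new_edges p u v (newpt s) y ->
  0 <= orient (p u) (p v) y * det f g.
Proof.
have l_side l : 0 <= l -> 0 <= l * (s * s) * det f g * det f g.
  move=> l0; rewrite -mulrA; apply: mulr_ge0; last exact/ltW/det_sqr_gt0.
  by rewrite mulr_ge0 // -expr2 sqr_ge0.
by case=> /segmentP[l [l0 l1 ->]]; rewrite ?pt_u ?pt_v orient_chart l_side.
Qed.

Lemma new_edges_line s y : s != 0 -> new_edges p u v (newpt s) y ->
  orient (p u) (p v) y = 0 -> y = p u \/ y = p v.
Proof.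
have l_line l : s != 0 -> l * (s * s) * det f g = 0 -> l = 0.
  by move=> /negbTE s0 /eqP; rewrite !mulf_eq0 s0 (negbTE det_fg) !orbF => /eqP.
by move=> s0 [] /segmentP[l [l0 l1 ->]]; rewrite ?pt_u ?pt_v orient_chart => /(l_line _ s0) ->;
  rewrite !mul0r ?sub0r ?chart_u ?chart_v; [left|right].
Qed.

Lemma newpt_near (e : R) : 0 < e -> \forall s \near (0 : R)^'+, `|newpt s - p v| < e.
Proof.
move=> e0; near=> s.
have s0 : 0 < s by near: s; exact: nbhs_right_gt.
have s1 : s < 1 by near: s; exact: nbhs_right_lt.
have se : s * (`|f| + `|g|) < e by near: s; exact: near_small.
have -> : newpt s - p v = s *: (f + s *: g).
  by apply: pair_eq; rewrite !coordE; ring.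
rewrite normrZ gtr0_norm //; apply: le_lt_trans se; apply: ler_wpM2l; first exact: ltW.
apply: (le_trans (ler_normD _ _)); rewrite lerD2l normrZ gtr0_norm //.
by rewrite -[leRHS]mul1r ler_wpM2r // ltW.
Unshelve. all: by end_near. Qed.

(** * The sliver [uvx] seen from the cone, at a fixed scale *)

Section FixedScale.
Variable s : R.
Hypotheses (s_gt0 : 0 < s) (s_lt1 : s < 1) (s_ltk : 8 * s < k).
Hypothesis base_escapes : escapes (D' s) (chart (k / 2) 0).

Section Side.
(* A half-plane, in the coordinates of [chart], that misses both new edges. *)
Variables a b c : R.
Hypotheses (side_u : c <= a) (side_v : c <= 0)
  (side_x : a * s + b * (s * s) + c <= 0).

(** The hypotheses of the section say that the affine function is nonpositive at [u], [v] and [x],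
    hence on both new edges. *)
Lemma side_avoid t r : cone t r -> 0 < a * t + b * r + c -> ~ D' s (chart t r).
Proof.
have [su sv sx] := And3 side_u side_v side_x.
move=> tr tr0; rewrite drawing_place // => -[|]; first exact: cone_D.
case=> /segmentP[l [l0 l1]].
  rewrite -chart_u chart_pt => /chart_inj[tE rE].
  have : 0 <= (1 - l) * (a - c) by apply: mulr_ge0; lra.
  have : 0 <= l * - (a * s + b * (s * s) + c) by apply: mulr_ge0; lra.
  by move: tr0; rewrite tE rE; lra.
rewrite -chart_v chart_pt => /chart_inj[tE rE].
have : 0 <= (1 - l) * - c by apply: mulr_ge0; lra.
have : 0 <= l * - (a * s + b * (s * s) + c) by apply: mulr_ge0; lra.
by move: tr0; rewrite tE rE; lra.
Qed.

Lemma side_clear t r t' r' : cone t r -> 0 <= a * t + b * r + c ->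
  cone t' r' -> 0 < a * t' + b * r' + c -> clear (D' s) (chart t r) (chart t' r').
Proof.
move=> tr tr0 tr' tr'0 l l0 l1; rewrite chart_pt; apply: side_avoid.
  by apply: cone_pt => //; exact: ltW.
have : 0 <= (1 - l) * (a * t + b * r + c) by apply: mulr_ge0; lra.
have : 0 < l * (a * t' + b * r' + c) by apply: mulr_gt0; lra.
by lra.
Qed.

Lemma side_escapes t r t' r' : cone t r -> 0 < a * t + b * r + c ->
  cone t' r' -> 0 < a * t' + b * r' + c -> escapes (D' s) (chart t' r') ->
  escapes (D' s) (chart t r).
Proof.
move=> tr tr0 tr' tr'0; apply: escapes_step; first exact: drawing_compact.
move=> _ /segmentP[l [l0 l1 ->]]; rewrite chart_pt; apply: side_avoid.
  exact: cone_pt.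
have : 0 <= (1 - l) * (a * t' + b * r' + c) by apply: mulr_ge0; lra.
have := @conv_gt _ l _ _ 0 l0 l1 tr'0 tr0; lra.
Qed.

End Side.

Lemma cone_sq (t c : R) : s / 2 <= t -> t < k -> `|c| * (2 * s) < k ->
  cone t (c * (s * s)).
Proof.
have [s0 k0] := conj s_gt0 k_gt0.
move=> st tk ck; split => //; first by lra.
rewrite !normrM (gtr0_norm s0).
have : s * (`|c| * (2 * s)) < s * k by rewrite ltr_pM2l.
have : k * (s / 2) <= k * t by rewrite ler_pM2l.
by lra.
Qed.

(** The bound 4 on the factor matches [8 * s < k]; the explicit witnesses below have factors at most
    3. *)
Lemma cone_sq4 (t c : R) : s / 2 <= t -> t < k -> 0 <= c -> c <= 4 -> cone t (c * (s * s)).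
Proof.
have [s0 sk] := conj s_gt0 s_ltk.
move=> st tk c0 c4; apply: cone_sq => //; rewrite ger0_norm //.
have : c * s <= 4 * s by rewrite ler_pM2r.
by lra.
Qed.

Lemma cone_base : cone (k / 2) 0.
Proof. by have k0 := k_gt0; split; rewrite ?normr0 ?mulr_gt0 //; lra. Qed.

Lemma beyond_escapes t r : cone t r -> s < t -> escapes (D' s) (chart t r).
Proof.
have [s0 sk] := conj s_gt0 s_ltk.
move=> tr st; by apply: (@side_escapes 1 0 (- s) _ _ _ _ _ (k / 2) 0) => //;
  first [exact: cone_base | lra].
Qed.

Lemma newpt_cone : cone s (s * s).
Proof.
have [s0 sk] := conj s_gt0 s_ltk.
by rewrite -[s * s]mul1r; apply: cone_sq4; lra.
Qed.

Lemma newpt_notin : ~ D (newpt s).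
Proof. exact/cone_D/newpt_cone. Qed.

(** The region is the side of the line [ux] away from [v]; its waypoint [(2 * s, 3 * s^2)] also lies
    beyond [x]. *)
Lemma right_escapes t r : cone t r -> s * s * (1 + t) < r * (1 + s) ->
  escapes (D' s) (chart t r).
Proof.
have [s0 sk] := conj s_gt0 s_ltk.
move=> tr tr0; have c3 : cone (2 * s) (3 * (s * s)) by apply: cone_sq4; lra.
apply: (@side_escapes (- (s * s)) (1 + s) (- (s * s)) _ _ _ _ _ (2 * s) (3 * (s * s))) => //;
  try nra.
by apply: beyond_escapes => //; lra.
Qed.

(** The region is the side of the line [vx] away from [u], with waypoint [(2 * s, 0)]. *)
Lemma left_escapes t r : cone t r -> r < s * t -> escapes (D' s) (chart t r).
Proof.
have [s0 sk] := conj s_gt0 s_ltk.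
move=> tr tr0; have c0 : cone (2 * s) (0 * (s * s)) by apply: cone_sq4; lra.
apply: (@side_escapes s (-1) 0 _ _ _ _ _ (2 * s) (0 * (s * s))) => //; try nra.
by apply: beyond_escapes => //; lra.
Qed.

Lemma slot_place_u : slot (q s) (Some u) None.
Proof.
have [s0 sk s1] := And3 s_gt0 s_ltk s_lt1.
have c1 : cone (2 * s + s * s) ((1 + s) * (s * s)) by apply: cone_sq4; nra.
have E : newpt s + s *: (newpt s - p u) = chart (2 * s + s * s) ((1 + s) * (s * s)).
  by rewrite -chart_u /newpt /chart; apply: pair_eq; rewrite !coordE; ring.
(* The edge [ux] has chart width [1 + s], so it is prolonged only by the fraction [s] of itself to
   stay in the cone; [vx] can simply be doubled. *)
exists s; rewrite /= E; split => //; last by apply: beyond_escapes => //; nra.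
by apply: (@side_clear 1 0 (- s)) => //; first [exact: newpt_cone | nra].
Qed.

Lemma slot_place_v : slot (q s) (Some v) None.
Proof.
have [s0 sk s1] := And3 s_gt0 s_ltk s_lt1.
have c1 : cone (2 * s) (2 * (s * s)) by apply: cone_sq4; nra.
have E : newpt s + 1 *: (newpt s - p v) = chart (2 * s) (2 * (s * s)).
  by rewrite -chart_v /newpt /chart; apply: pair_eq; rewrite !coordE; ring.
exists 1; rewrite /= E; split => //; last by apply: beyond_escapes => //; nra.
by apply: (@side_clear 1 0 (- s)) => //; first [exact: newpt_cone | nra].
Qed.

Lemma visible_place_u : visible (q s) (Some u) None.
Proof.
have [s0 sk s1] := And3 s_gt0 s_ltk s_lt1.
have dg := det_sqr_gt0.
(* The parameter at which [ux] has abscissa [s / 2]: past [v], hence in the cone and off the old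
   drawing, and above [vx]. *)
pose l := (1 + s / 2) / (1 + s).
have s1' : 0 < 1 + s by lra.
have lE : l * (1 + s) = 1 + s / 2 by rewrite /l mulfVK // gt_eqF.
have l0 : 0 <= l by rewrite divr_ge0; lra.
have l1 : l <= 1 by rewrite ler_pdivrMr; lra.
have mE : pt (p u) (newpt s) l = chart (s / 2) (l * (s * s)).
  rewrite -chart_u chart_pt; congr chart; last by ring.
  by transitivity (l * (1 + s) - 1); [ring|rewrite lE; ring].
have cm : cone (s / 2) (l * (s * s)) by apply: cone_sq4; lra.
have cz : cone (2 * s) (3 * (s * s)) by apply: cone_sq4; lra.
have crE : orient (p u) (newpt s) (chart (2 * s) (3 * (s * s))) = s * s * (2 + s) * det f g.
  by rewrite -chart_u /newpt /chart /orient /det !coordE; ring.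
exists (pt (p u) (newpt s) l), (chart (2 * s) (3 * (s * s))); split.
- split; first exact: segment_pt.
  rewrite mE => /other_place_u[|]; first exact: cone_D.
  move=> /segmentP[l' [_ _]]; rewrite -chart_v chart_pt => /chart_inj[tE rE].
  have : (l' - 1 / 2) * s = 0 by lra.
  move/eqP; rewrite mulf_eq0 (gt_eqF s0) orbF subr_eq0 => /eqP l'E.
  have : (l - 1 / 2) * (s * s) = 0 by rewrite l'E in rE; lra.
  by nra.
- rewrite mE; apply: (@side_clear (- (s * s)) (1 + s) (- (s * s))) => //; try nra.
- apply: beyond_escapes => //; lra.
- by rewrite crE !mulf_neq0 // gt_eqF //; lra.
- move=> [c|] //= /[swap] /orP[/eqP->|/eqP-> _]; first by rewrite adj_irrefl.
  have -> : orient (p u) (newpt s) (p v) = - (s * s * det f g).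
    by rewrite -chart_u -chart_v /newpt /chart /orient /det !coordE; ring.
  rewrite crE; have : 0 < (s * s) * (s * s) * (2 + s) * (det f g * det f g).
    by apply: mulr_gt0 => //; rewrite !mulr_gt0 //; lra.
  by lra.
Qed.

Lemma visible_place_v : visible (q s) (Some v) None.
Proof.
have [s0 sk s1] := And3 s_gt0 s_ltk s_lt1.
have dg := det_sqr_gt0.
have mE : pt (p v) (newpt s) (1 / 2) = chart (s / 2) (1 / 2 * (s * s)).
  by rewrite -chart_v chart_pt; congr chart; ring.
have cm : cone (s / 2) (1 / 2 * (s * s)) by apply: cone_sq4; lra.
have cz : cone (2 * s) (0 * (s * s)) by apply: cone_sq4; lra.
have crE : orient (p v) (newpt s) (chart (2 * s) (0 * (s * s))) = - (2 * s * (s * s) * det f g).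
  by rewrite -chart_v /newpt /chart /orient /det !coordE; ring.
exists (pt (p v) (newpt s) (1 / 2)), (chart (2 * s) (0 * (s * s))); split.
- split; first by apply: segment_pt; lra.
  rewrite mE => /other_place_v[|]; first exact: cone_D.
  move=> /segmentP[l' [_ _]]; rewrite -chart_u chart_pt => /chart_inj[tE rE].
  have : (l' - 1 / 2) * (s * s) = 0 by lra.
  move/eqP; rewrite mulf_eq0 mulf_eq0 (gt_eqF s0) !orbF subr_eq0 => /eqP l'E.
  by rewrite l'E in tE; lra.
- by rewrite mE; apply: (@side_clear s (-1) 0) => //; nra.
- by apply: beyond_escapes => //; lra.
- by rewrite crE oppr_eq0 !mulf_neq0 // gt_eqF //; lra.
- move=> [c|] //= /[swap] /orP[/eqP-> _|/eqP->]; last by rewrite adj_irrefl.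
  have -> : orient (p v) (newpt s) (p u) = s * s * det f g.
    by rewrite -chart_u -chart_v /newpt /chart /orient /det !coordE; ring.
  rewrite crE; have : 0 < (s * s) * (s * s) * s * (det f g * det f g).
    by apply: mulr_gt0 => //; rewrite !mulr_gt0 //; lra.
  by lra.
Qed.

End FixedScale.

(** * Conditions that hold for all small scales *)

Lemma near_avoid_vertex : \forall s \near (0 : R)^'+, forall w, w != u -> w != v ->
  ~ new_edges p u v (newpt s) (p w).
Proof.
apply: filter_forall => w.
have [->|wu] := eqVneq w u; first exact: nearW.
have [->|wv] := eqVneq w v; first by apply: nearW.
have [|e e0 He] := segment_move (@compact_set1 _ (p w)) (_ : _ `&` segment (p u) (p v) = set0).
  rewrite -subset0 => y [-> /(grow_edge gr uv)[] /eqP].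
    by rewrite (negbTE wu).
  by rewrite (negbTE wv).
near=> s => _ _ Nw.
have : ([set p w] `&` new_edges p u v (newpt s)) (p w) by [].
by rewrite /new_edges He //; near: s; exact: newpt_near.
Unshelve. all: by end_near. Qed.

Lemma near_escapes z : escapes D z -> \forall s \near (0 : R)^'+, escapes (D' s) z.
Proof.
move=> /(escapes_place uv)[e e0 He]; near=> s; apply: He; last by rewrite subrr normr0.
by near: s; exact: newpt_near.
Unshelve. all: by end_near. Qed.

Lemma near_clear m z : ~ segment (p u) (p v) m -> clear D m z ->
  \forall s \near (0 : R)^'+, clear (D' s) m z /\ ~ new_edges p u v (newpt s) m.
Proof.
move=> uvm mz; have [e e0 He] := clear_place uv uvm mz.
by near=> s; apply: He; near: s; exact: newpt_near.
Unshelve. all: by end_near. Qed.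

Lemma near_nonedge_old a b : a != b -> ~~ adj a b -> \forall s \near (0 : R)^'+,
  exists2 z, segment (p a) (p b) z & escapes (D' s) z.
Proof.
move=> ab nab; have [z abz /near_escapes zD] := grow_nonedge gr ab nab.
by near=> s; exists z => //; near: s.
Unshelve. all: by end_near. Qed.

(** The pair [m0], [z0] is kept: the new edges lie on the other closed side of the line [uv] and
    meet that line only in [u] and [v]. *)
Lemma near_visible_uv : \forall s \near (0 : R)^'+, visible (q s) (Some u) (Some v).
Proof.
have dg := det_sqr_gt0.
pose zeta := orient (p u) (p v) z0; have zg : det f g * zeta < 0 := g_side.
have z0D := near_escapes z0_escapes.
have zeta0 : zeta != 0.
  by apply: contraTneq zg => ->; rewrite mulr0 ltxx.
have crm0 := orient_segment m0_uv.
have in_range w : m0 <> p w.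
  by move=> mw; apply: m0_other; left; exists w.
near=> s.
have s0 : 0 < s by near: s; exact: nbhs_right_gt.
have ss0 : 0 < s * s by rewrite mulr_gt0.
exists m0, z0; split => //.
- split => // /other_place_old[//|] Nm.
  by have [/in_range|/in_range] := new_edges_line (lt0r_neq0 s0) Nm crm0.
- move=> t t0 t1; rewrite drawing_place // => -[|]; first exact: m0_clear.
  have tz : t * (det f g * zeta) < 0 by rewrite pmulr_rlt0.
  have crt : orient (p u) (p v) (pt m0 z0 t) = t * zeta.
    by rewrite orient_pt crm0 mulr0 add0r.
  by move=> /new_edges_side; rewrite crt; lra.
- by near: s.
- move=> [c|] /=; first exact: z0_side.
  by move=> _ _; rewrite orient_chart -/zeta; move: zg ss0; nra.
Unshelve. all: by end_near. Qed.

Lemma near_visible_old a b : adj a b ->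
  \forall s \near (0 : R)^'+, visible (q s) (Some a) (Some b).
Proof.
move=> ab; have [[-> ->]|n1] := eqVneq (a, b) (u, v); first exact: near_visible_uv.
have [[-> ->]|n2] := eqVneq (a, b) (v, u).
  by apply: filterS near_visible_uv => s; exact: visibleC.
have [m [z [[abm om] mz zD crz hc]]] := grow_visible gr ab.
have uvm : ~ segment (p u) (p v) m.
  move=> uvm; apply: om; apply/other_edgesP; right; exists u, v; split => //.
    by rewrite eq_sym.
  by apply: contra n2 => /eqP[-> ->].
have zD' := near_escapes zD; have mz' := near_clear uvm mz.
near=> s; have [mzs ms] : clear (D' s) m z /\ ~ new_edges p u v (newpt s) m by near: s.
exists m, z; split => //.
- by split => // /other_place_old[].
- by near: s.
- move=> [c|] /=; first exact: hc.
  move=> /orP[]/eqP aE /orP[]/eqP bE; subst.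
  + by rewrite adj_irrefl in ab.
  + by rewrite eqxx in n1.
  + by rewrite eqxx in n2.
  + by rewrite adj_irrefl in ab.
Unshelve. all: by end_near. Qed.

(** Both new edges point along small perturbations of [f]: [newpt s - p v] is a positive multiple of
    [f + s *: g], and [newpt s - p u] one of [f + (s * s / (1 + s)) *: g]. *)
Lemma near_diverge e : diverge e f ->
  \forall s \near (0 : R)^'+, diverge e (newpt s - p u) /\ diverge e (newpt s - p v).
Proof.
move=> /(diverge_near g) ef; near=> s.
have efk : forall k, `|k| <= s -> diverge e (f + k *: g) by near: s.
have s0 : 0 < s by near: s; exact: nbhs_right_gt.
split; last first.
  have -> : newpt s - p v = s *: (f + s *: g).
    by rewrite -chart_v /newpt /chart; apply: pair_eq; rewrite !coordE; ring.
  by apply/divergeC/diverge_scale => //; apply/divergeC/efk; rewrite gtr0_norm.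
have s1 : 0 < 1 + s by lra.
have -> : newpt s - p u = (1 + s) *: (f + (s * s / (1 + s)) *: g).
  rewrite scalerDr scalerA mulrCA divff ?gt_eqF // mulr1.
  by rewrite -chart_u /newpt /chart; apply: pair_eq; rewrite !coordE; ring.
apply/divergeC/diverge_scale => //; apply/divergeC/efk.
rewrite ger0_norm ?divr_ge0 ?mulr_ge0 ?(ltW s0) ?(ltW s1) //.
by rewrite ler_pdivrMr //; nra.
Unshelve. all: by end_near. Qed.

Lemma near_slot_u a : L a u -> \forall s \near (0 : R)^'+, slot (q s) (Some a) (Some u).
Proof.
move=> Lau; have [j [j0 cl zD]] := grow_slot gr Lau.
have au : p u != p a.
  by apply: contra (adj_neq (grow_sub gr Lau)) => /eqP/(grow_inj gr)->.
have vu : p v != p u.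
  by apply: contra (adj_neq uv) => /eqP/(grow_inj gr)->.
set e := j *: (p u - p a) in cl zD.
have e0 : e != 0 by rewrite scaler_eq0 subr_eq0 gt_eqF.
have /near_diverge ef : diverge e f.
  by rewrite fE; apply: clear_diverge cl (edge_drawing uv).
have zD' := near_escapes zD.
(* The edge [vx] is treated as a perturbation of the degenerate segment at [v]. *)
have [|r r0 Hr] := segment_move (@segment_compact2 _ (p u) (p u + e))
   (_ : _ `&` segment (p v) (p v) = set0).
  rewrite -subset0 => y [/segmentP[t [t0 t1 ->]]] /segmentP[t' [_ _]].
  have -> : pt (p v) (p v) t' = p v by apply: pair_eq; rewrite !coordE; ring.
  move: t0; rewrite le_eqVlt => /orP[/eqP <-|t0 E].
    by rewrite pt_0 => E; rewrite E eqxx in vu.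
  by apply: (cl t t0 t1); rewrite E; exact: vertex_drawing.
near=> s; exists j; split => //; rewrite /= -/e; last by near: s.
have [efu _] : diverge e (newpt s - p u) /\ diverge e (newpt s - p v) by near: s.
move=> t t0 t1; rewrite drawing_place // => -[|[/segmentP[l [l0 l1 E]]|vt]].
- exact: cl.
- apply: (diverge_neq efu t0 l0); apply: (addrI (p u)).
  transitivity (pt (p u) (p u + e) t); first by apply: pair_eq; rewrite !coordE; ring.
  by rewrite E; apply: pair_eq; rewrite !coordE; ring.
- have sr : `|newpt s - p v| < r by near: s; exact: newpt_near.
  have : (segment (p u) (p u + e) `&` (segment (p v) (newpt s) `|` segment (p v) (newpt s)))
     (pt (p u) (p u + e) t).
    by split; [apply: segment_pt => //; exact: ltW|left].
  by rewrite Hr.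
Unshelve. all: by end_near. Qed.

(** For [a = u] the prolongation lies on the line [uv]. Otherwise [grow_triangle] makes [a] a common
    neighbour, on the side of [x]; the prolongation leaves on the opposite side, away from [ux], and
    its direction differs from that of [vx]. *)
Lemma near_slot_v a : L a v -> \forall s \near (0 : R)^'+, slot (q s) (Some a) (Some v).
Proof.
move=> Lav; have [j [j0 cl zD]] := grow_slot gr Lav.
set e := j *: (p v - p a) in cl zD.
have zD' := near_escapes zD.
have crt t : orient (p u) (p v) (pt (p v) (p v + e) t) = - (t * j * orient (p u) (p v) (p a)).
  by rewrite /e /orient !coordE; ring.
have [au|au] := eqVneq a u.
  near=> s; exists j; split => //; rewrite /= -/e; last by near: s.
  have s0 : 0 < s by near: s; exact: nbhs_right_gt.
  move=> t t0 t1; rewrite drawing_place // => -[|N]; first exact: cl.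
  have cr0 : orient (p u) (p v) (pt (p v) (p v + e) t) = 0.
    by rewrite crt au /orient; ring.
  by have [E|E] := new_edges_line (lt0r_neq0 s0) N cr0; apply: (cl t t0 t1);
    rewrite E; exact: vertex_drawing.
have va : adj v a by rewrite adj_sym; exact: (grow_sub gr Lav).
have ua : adj u a by rewrite adj_sym; exact: (grow_triangle gr Lav Luv au).
have /near_diverge ef : diverge e f.
  have := growable_diverge gr va (_ : adj v u) au; rewrite adj_sym => /(_ uv).
  move/divergeNN; rewrite !opprB -fE => /(diverge_scale j0); exact.
near=> s; exists j; split => //; rewrite /= -/e; last by near: s.
have [_ efv] : diverge e (newpt s - p u) /\ diverge e (newpt s - p v) by near: s.
move=> t t0 t1; rewrite drawing_place // => -[|[N|/segmentP[l [l0 l1 E]]]].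
- exact: cl.
- have := @new_edges_side s _ (or_introl N); rewrite crt.
  have := z0_side ua va; have := g_side.
  set D0 := det f g; set A := orient _ _ (p a); set Z := orient _ _ z0 => DZ AZ.
  have Z0 : Z != 0 by apply: contraTneq DZ => ->; rewrite mulr0 ltxx.
  have ZZ : 0 < Z * Z by rewrite -expr2 lt_def sqrf_eq0 Z0 sqr_ge0.
  have AD : 0 < A * D0.
    rewrite -(pmulr_lgt0 _ ZZ).
    have -> : (A * D0) * (Z * Z) = (D0 * Z) * (A * Z) by ring.
    by rewrite nmulr_rgt0.
  have : 0 < t * j * (A * D0) by rewrite mulr_gt0 // mulr_gt0.
  by lra.
- apply: (diverge_neq efv t0 l0); apply: (addrI (p v)).
  transitivity (pt (p v) (p v + e) t); first by apply: pair_eq; rewrite !coordE; ring.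
  by rewrite E; apply: pair_eq; rewrite !coordE; ring.
Unshelve. all: by end_near. Qed.

Lemma near_slot_old a b : L a b ->
  \forall s \near (0 : R)^'+, slot (q s) (Some a) (Some b).
Proof.
have [->|bu] := eqVneq b u; first exact: near_slot_u.
have [->|bv] := eqVneq b v; first exact: near_slot_v.
move=> Lab; have [j [j0 cl zD]] := grow_slot gr Lab.
have uvb : ~ segment (p u) (p v) (p b).
  by move=> /(grow_edge gr uv)[] /eqP; apply/negP.
have zD' := near_escapes zD; have cl' := near_clear uvb cl.
near=> s; exists j; split => //=; last by near: s.
by have [] : clear (D' s) (p b) (p b + j *: (p b - p a)) /\ ~ new_edges p u v (newpt s) (p b)
  by near: s.
Unshelve. all: by end_near. Qed.

Lemma chart_coords y : exists a b : R, y = chart a b.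
Proof.
exists (det (y - p v) g / det f g), (det f (y - p v) / det f g).
by apply: pair_eq; have := det_fg; rewrite /det !coordE => ?; field.
Qed.

Lemma near_fixed : \forall s \near (0 : R)^'+,
  [/\ 0 < s, s < 1, 8 * s < k & escapes (D' s) (chart (k / 2) 0)].
Proof.
have kD := near_escapes chart_escapes; near=> s; split.
- by near: s; exact: nbhs_right_gt.
- by near: s; exact: nbhs_right_lt.
- by rewrite mulrC; near: s; exact: near_small.
- by near: s.
Unshelve. all: by end_near. Qed.

(** The segment [xw] runs close to the edge [vw], so no old witness exists; a new one is taken close
    to [x], where [xw] leaves the sliver across [ux] or [vx]. *)
Lemma near_nonedge_adj w : w != u -> adj v w -> \forall s \near (0 : R)^'+,
  exists2 z, segment (newpt s) (p w) z & escapes (D' s) z.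
Proof.
move=> wu vw; have [j [j0 cl _]] := grow_slot gr Luv.
have vu : adj v u by rewrite adj_sym.
have w_v : p w != p v.
  by rewrite eq_sym; apply: contra (adj_neq vw) => /eqP/(grow_inj gr)->.
have v_u : p v - p u != 0.
  by rewrite subr_eq0 eq_sym; apply: contra (adj_neq uv) => /eqP/(grow_inj gr)->.
have [al [be wE]] := chart_coords (p w).
(* The edge [vw] diverges from [vu] and from the slot direction [f], so [w] is off the line [uv]. *)
have be0 : be != 0.
  have d1 : diverge (p w - p v) (- f).
    by rewrite fE opprB; apply: growable_diverge gr vw vu wu.
  have d2 : diverge (p w - p v) f.
    have -> : f = j^-1 *: (j *: (p v - p u)).
      by rewrite scalerA mulVf ?gt_eqF // scale1r fE.
    apply/divergeC/diverge_scale; first by rewrite invr_gt0.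
    apply: clear_diverge cl (edge_drawing vw) => //.
    by rewrite scaler_eq0 negb_or v_u gt_eqF.
  have := diverge_det d2 d1; apply: contra => /eqP be0.
  by rewrite wE be0 -chart_v /chart /det !coordE; apply/eqP; ring.
have nbe : 0 < `|be| by rewrite normr_gt0.
have fixed := near_fixed.
near=> s; have [s0 s1 sk base] : [/\ 0 < s, s < 1, 8 * s < k & escapes (D' s) (chart (k / 2) 0)]
  by near: s.
have sal : s * (`|al| + 1) < 1 / 2 by near: s; apply: near_small; lra.
have sbe : s * (2 * (2 + `|be|)) < k by near: s; exact: near_small.
have sab : s * (1 + `|al|) < `|be| by near: s; exact: near_small.
have ss0 : 0 < s * s by rewrite mulr_gt0.
have yE : pt (newpt s) (p w) (s * s) =
    chart (s + s * s * (al - s)) ((1 + be - s * s) * (s * s)).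
  by rewrite {1}wE chart_pt; congr chart; ring.
have ss1 : s * s <= 1 by rewrite mulr_ile1 // ltW.
(* At parameter [s^2] the height changes by about [be * s^2], comparable to that of [x], while the
   abscissa stays of order [s]: the sign of [be] decides the side. *)
exists (pt (newpt s) (p w) (s * s)); first exact: segment_pt (ltW ss0) ss1.
have [b1 b2 b3] := stub_cone s0 s1 sk sal sbe.
have cy : cone (s + s * s * (al - s)) ((1 + be - s * s) * (s * s)) by exact: cone_sq.
rewrite yE; have [b0|b0|b0] := ltgtP be 0; last by have := be0; rewrite b0 eqxx.
  by apply: left_escapes => //; exact: stub_left.
by apply: right_escapes => //; exact: stub_right.
Unshelve. all: by end_near. Qed.

(** If [vw] is a non-edge as well, its witness is moved to the same parameter on [xw]. *)
Lemma near_nonedge_new w : w != u -> w != v -> \forall s \near (0 : R)^'+,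
  exists2 z, segment (newpt s) (p w) z & escapes (D' s) z.
Proof.
move=> wu wv; have [vw|vw] := boolP (adj v w); first exact: near_nonedge_adj.
rewrite eq_sym in wv; have [z /segmentP[t [t0 t1 ->]] /(escapes_place uv)[e e0 He]] :=
  grow_nonedge gr wv vw.
near=> s; have se : `|newpt s - p v| < e by near: s; exact: newpt_near.
exists (pt (newpt s) (p w) t); first exact: segment_pt.
apply: He => //; apply: le_lt_trans (norm_pt_sub _ _ _ _ t0 t1) _.
by rewrite subrr normr0 max_l.
Unshelve. all: by end_near. Qed.

Lemma near_growable :
  \forall s \near (0 : R)^'+, growable (q s) (@later H L u v).
Proof.
(* Lets a decidable premise be moved inside the filter, so that quantifiers over the finite vertex
   set can follow. *)
have impl (P : bool) (Q : R -> Prop) : (P -> \forall s \near (0 : R)^'+, Q s) ->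
    \forall s \near (0 : R)^'+, P -> Q s.
  by case: P => [/(_ isT) h|_]; [apply: filterS h|apply: nearW].
have avoid := near_avoid_vertex; have fixed := near_fixed.
have old_non : \forall s \near (0 : R)^'+, forall a b, a != b -> ~~ adj a b ->
    exists2 z, segment (p a) (p b) z & escapes (D' s) z.
  apply: filter_forall => a; apply: filter_forall => b.
  by apply: (impl) => ab; apply: (impl) => nab; exact: near_nonedge_old.
have new_non : \forall s \near (0 : R)^'+, forall w, w != u -> w != v ->
    exists2 z, segment (newpt s) (p w) z & escapes (D' s) z.
  apply: filter_forall => w; apply: (impl) => wu; apply: (impl) => wv.
  exact: near_nonedge_new.
have old_vis : \forall s \near (0 : R)^'+, forall a b, adj a b ->
    visible (q s) (Some a) (Some b).
  apply: filter_forall => a; apply: filter_forall => b; apply: (impl) => ab.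
  exact: near_visible_old.
have old_slot : \forall s \near (0 : R)^'+, forall a b, L a b ->
    slot (q s) (Some a) (Some b).
  apply: filter_forall => a; apply: filter_forall => b; apply: (impl) => ab.
  exact: near_slot_old.
near=> s; have [s0 s1 sk base] : [/\ 0 < s, s < 1, 8 * s < k & escapes (D' s) (chart (k / 2) 0)]
  by near: s.
have xD : ~ D (newpt s) by exact: newpt_notin.
have avoid_s : forall w, w != u -> w != v -> ~ new_edges p u v (newpt s) (p w) by near: s.
have ux w : segment (p u) (newpt s) (p w) -> w = u.
  move=> uw; have [//|wu] := eqVneq w u; have [wv|wv] := eqVneq w v; last first.
    by case: (avoid_s w wu wv); left.
  move: uw; rewrite wv => /segmentP[l [_ _]]; rewrite pt_u -chart_v => /chart_inj[tE /esym/eqP].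
  by rewrite !mulf_eq0 (gt_eqF s0) !orbF => /eqP l0; exfalso; rewrite l0 in tE; lra.
have vx w : segment (p v) (newpt s) (p w) -> w = v.
  move=> vw; have [//|wv] := eqVneq w v; have [wu|wu] := eqVneq w u; last first.
    by case: (avoid_s w wu wv); right.
  move: vw; rewrite wu => /segmentP[l [_ _]]; rewrite pt_v -chart_u => /chart_inj[tE /esym/eqP].
  by rewrite !mulf_eq0 (gt_eqF s0) !orbF => /eqP l0; exfalso; rewrite l0 in tE; lra.
split.
- move=> [a|] [b|] //= ab; [by rewrite (grow_inj gr ab)|..].
    by case: xD; rewrite -ab; exact: vertex_drawing.
  by case: xD; rewrite ab; exact: vertex_drawing.
- move=> [a|] [b|] [w|] //= ab.
  + by move=> /(grow_edge gr ab)[]->; [left|right].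
  + by move=> /(edge_drawing ab).
  + by case/orP: ab => /eqP -> h; left; congr Some; [exact: ux|exact: vx].
  + by right.
  + by rewrite segmentC; case/orP: ab => /eqP -> h; right; congr Some; [exact: ux|exact: vx].
  + by left.
- have old_non_s : forall a b, a != b -> ~~ adj a b ->
    exists2 z, segment (p a) (p b) z & escapes (D' s) z by near: s.
  have new_non_s : forall w, w != u -> w != v ->
    exists2 z, segment (newpt s) (p w) z & escapes (D' s) z by near: s.
  move=> [a|] [b|] //=.
  + exact: old_non_s.
  + by move=> _; rewrite negb_or segmentC => /andP[]; exact: new_non_s.
  + by move=> _; rewrite negb_or => /andP[]; exact: new_non_s.
- have old_vis_s : forall a b, adj a b -> visible (q s) (Some a) (Some b) by near: s.
  move=> [a|] [b|] //=.
  + exact: old_vis_s.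
  + by move=> /orP[]/eqP->; [exact: visible_place_u|exact: visible_place_v].
  + by move=> /orP[]/eqP->; apply: visibleC; [exact: visible_place_u|exact: visible_place_v].
- have old_slot_s : forall a b, L a b -> slot (q s) (Some a) (Some b) by near: s.
  move=> [a|] [b|] //=; first exact: old_slot_s.
  by move=> /orP[]/eqP->; [exact: slot_place_u|exact: slot_place_v].
- by move=> [a|] [b|] //=; exact: (grow_sub gr).
- move=> [a|] [b|] //=; first exact: (grow_cover gr).
  by move=> ->.
- move=> [b|]; last by exists (Some u); rewrite /= eqxx.
  by have [a Lab] := grow_vertex gr b; exists (Some a).
- move=> [a|] [b|] [c|] //=; first exact: (grow_triangle gr).
  move=> /orP[]/eqP-> /orP[]/eqP-> //; rewrite ?eqxx //.
  by rewrite adj_sym.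
Unshelve. all: by end_near. Qed.

End Step.

(** Rewriting [chart t r] with slope [r / t] reduces to one thin cone per edge. Vertices need no
    case of their own, each being an end of an edge by [grow_vertex]. *)
Lemma cone_avoids (R : realType) (H : sgraph) (p : H -> R * R) (L : rel H)
    (u v : H) (g : R * R) :
  growable p L -> L u v -> \forall k \near (0 : R)^'+,
  forall t r, cone k t r -> ~ drawing_set p (chart p v (p v - p u) g t r).
Proof.
move=> gr Luv; set f := p v - p u.
have [j [j0 cl _]] := grow_slot gr Luv.
have neq a b : adj a b -> p b != p a.
  by move=> /adj_neq; rewrite eq_sym; apply: contra => /eqP/(grow_inj gr)->.
have f0 : f != 0 by rewrite subr_eq0 neq // (grow_sub gr Luv).
have edge_v w : adj v w -> \forall k \near (0 : R)^'+, forall t r, 0 < t -> `|r| < k ->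
    ~ segment (p v) (p w) (p v + t *: (f + r *: g)).
  move=> vw; apply: cone_edge; have -> : f = j^-1 *: (j *: f).
    by rewrite scalerA mulVf ?gt_eqF // scale1r.
  apply: diverge_scale; first by rewrite invr_gt0.
  apply: clear_diverge cl (edge_drawing vw); last exact: neq.
  by rewrite scaler_eq0 negb_or f0 gt_eqF.
have edge a b : adj a b -> \forall k \near (0 : R)^'+, forall t r, 0 < t -> t < k ->
    `|r| < k -> ~ segment (p a) (p b) (p v + t *: (f + r *: g)).
  move=> ab; have [va|va] := eqVneq v a.
    by rewrite va in edge_v *; apply: filterS (edge_v b ab) => k h t r t0 _; exact: h.
  have [vb|vb] := eqVneq v b.
    rewrite adj_sym in ab; rewrite segmentC -vb in ab *.
    by apply: filterS (edge_v a ab) => k h t r t0 _; exact: h.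
  apply: cone_far; first exact: segment_compact2.
  by move=> /(grow_edge gr ab)[]/eqP; apply/negP.
have all_edges : \forall k \near (0 : R)^'+, forall a b, adj a b -> forall t r,
    0 < t -> t < k -> `|r| < k -> ~ segment (p a) (p b) (p v + t *: (f + r *: g)).
  apply: filter_forall => a; apply: filter_forall => b.
  have [ab|_] := boolP (adj a b); last exact: nearW.
  by apply: filterS (edge a b ab) => k h _; exact: h.
near=> k => t r [t0 tk rk].
have kall : forall a b, adj a b -> forall t r, 0 < t -> t < k -> `|r| < k ->
  ~ segment (p a) (p b) (p v + t *: (f + r *: g)) by near: k.
have -> : chart p v f g t r = p v + t *: (f + (r / t) *: g).
  by rewrite scalerDr scalerA mulrCA divff ?gt_eqF // mulr1 addrA.
have rt : `|r / t| < k.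
  by rewrite normrM normfV (gtr0_norm t0) ltr_pdivrMr.
have inE a b : adj a b -> ~ segment (p a) (p b) (p v + t *: (f + (r / t) *: g)).
  by move=> ab; exact: kall.
case=> [[w _ wE]|[a [b [ab]]]]; last exact: inE.
have [a Law] := grow_vertex gr w.
apply: (inE a w (grow_sub gr Law)); rewrite -wE; exact: segment_r.
Unshelve. all: by end_near. Qed.

Lemma growable_extend (R : realType) (H : sgraph) (p : H -> R * R) (L : rel H)
    (u v : H) : growable p L -> L u v ->
  exists (q : extend u v -> R * R) (L' : rel (extend u v)), growable q L'.
Proof.
move=> gr Luv; have uv := grow_sub gr Luv.
have [m [z [[muv mo] mz zD zeta0 side]]] := grow_visible gr uv.
have [j [j0 cl jD]] := grow_slot gr Luv.
set f := p v - p u in cl jD.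
set zeta := orient (p u) (p v) z in zeta0 side.
have f0 : f != 0.
  by rewrite subr_eq0 eq_sym; apply: contra (adj_neq uv) => /eqP/(grow_inj gr)->.
(* A normal of [f] scaled by [- zeta], so that [x] falls on the side opposite to the witness [z]
   whatever the sign of [zeta]. *)
pose g : R * R := (zeta * f.2, - (zeta * f.1)).
have g_side : det f g * zeta < 0.
  have -> : det f g * zeta = - (zeta * zeta * dot f f) by rewrite /det /dot /g /=; ring.
  by rewrite oppr_lt0 mulr_gt0 ?dot_gt0 // -expr2 lt_def sqrf_eq0 zeta0 sqr_ge0.
have [k [k0 kj kcone]] : exists k : R, [/\ 0 < k, k < j
    & forall t r, cone k t r -> ~ drawing_set p (chart p v f g t r)].
  have avoids := cone_avoids g gr Luv.
  apply: (@filter_ex _ ((0 : R)^'+)); near=> k; split.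
  - by near: k; exact: nbhs_right_gt.
  - by near: k; exact: nbhs_right_lt.
  - by near: k.
have kD : escapes (drawing_set p) (chart p v f g (k / 2) 0).
  have -> : chart p v f g (k / 2) 0 = pt (p v) (p v + j *: f) (k / 2 / j).
    by apply: pair_eq; rewrite !coordE; field; rewrite gt_eqF.
  have l0 : 0 < k / 2 / j by rewrite !divr_gt0.
  have l1 : k / 2 / j <= 1 by rewrite ler_pdivrMr //; lra.
  exact: (escapes_clear (@drawing_compact _ _ p) cl jD l0 l1).
have near_s := near_growable gr Luv (erefl f) muv mo mz zD side g_side k0 kcone kD.
have [s gs] := @filter_ex _ ((0 : R)^'+) _ _ near_s.
by exists (@place R H p u v (newpt p v f g s)), (@later H L u v).
Unshelve. all: by end_near. Qed.

Lemma growable_iso (R : realType) (G H : sgraph) :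
  isomorphic G H ->
  (exists (p : G -> R * R) (L : rel G), growable p L) ->
  exists (p : H -> R * R) (L : rel H), growable p L.
Proof.
move=> [h [[h' hK h'K] h_adj]] [p [L gr]].
have h'_adj : {mono h' : x y / adj x y} by move=> x y; rewrite -h_adj !h'K.
have inj_h' : injective h' := can_inj h'K.
exists (p \o h'), [rel x y | L (h' x) (h' y)].
have DE : drawing_set (p \o h') = drawing_set p.
  apply/seteqP; split=> z [[x _ <-]|[x [y [xy xyz]]]].
  - by left; exists (h' x).
  - by right; exists (h' x), (h' y); rewrite h'_adj.
  - by left; exists (h x) => //=; rewrite hK.
  - by right; exists (h x), (h y); rewrite /= !hK h_adj.
have OE x y : other_edges (p \o h') x y `<=` other_edges p (h' x) (h' y).
  move=> z /other_edgesP[[w _ <-]|[c [d [cd n1 n2 cdz]]]]; apply/other_edgesP.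
    by left; exists (h' w).
  right; exists (h' c), (h' d); rewrite h'_adj; split => //.
    by apply: contra n1 => /eqP[/inj_h' -> /inj_h' ->].
  by apply: contra n2 => /eqP[/inj_h' -> /inj_h' ->].
split; rewrite ?DE /=.
- exact: inj_comp (grow_inj gr) inj_h'.
- move=> x y w; rewrite -h'_adj => /(grow_edge gr) h1 /h1.
  by move=> []/inj_h' ->; [left|right].
- move=> x y xy; rewrite -h'_adj; apply: (grow_nonedge gr).
  by apply: contra xy => /eqP/inj_h'->.
- move=> x y; rewrite -h'_adj => /(grow_visible gr)[m [z [[mxy mo] mz zD crz side]]].
  exists m, z; rewrite DE; split => //; first by split => // /OE.
  by move=> c; rewrite -![adj _ c]h'_adj; exact: side.
- by move=> x y /(grow_slot gr)[j [j0 cl jD]]; exists j; rewrite DE.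
- by move=> x y /(grow_sub gr); rewrite h'_adj.
- by move=> x y; rewrite -h'_adj; exact: (grow_cover gr).
- by move=> y; have [x Lxy] := grow_vertex gr (h' y); exists (h x); rewrite hK.
- move=> x y z Lxy Lzy xz; rewrite -h'_adj; apply: (grow_triangle gr Lxy Lzy).
  by apply: contra xz => /eqP/inj_h'->.
Qed.

(** * Two-trees *)

Lemma norm_coord (R : realType) (x : R * R) : `|x.1| <= `|x| /\ `|x.2| <= `|x|.
Proof. by rewrite {2 4}/Num.norm /= !le_max !lexx orbT. Qed.

(** The induction starts below the triangle, which is itself one stacking step. Orienting the edge
    both ways gives each of the two vertices a slot. *)
Lemma growable_K2 (R : realType) :
  @growable R (complete_graph 2) (fun i => ((i : nat)%:R, 0))
    [rel i j : 'I_2 | i != j].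
Proof.
set p := fun i : complete_graph 2 => ((i : nat)%:R : R, 0 : R).
have DE y : drawing_set p y -> [/\ 0 <= y.1, y.1 <= 1 & y.2 = 0].
  have val01 (i : 'I_2) : (0 : R) <= (i : nat)%:R <= (1 : R).
    by rewrite ler0n -[1]/(1%:R) ler_nat -ltnS ltn_ord.
  case=> [[i _ <-]|[i [j [_ /segmentP[t [t0 t1 ->]]]]]].
    by have /andP[? ?] := val01 i.
  have /andP[i0 i1] := val01 i; have /andP[j0 j1] := val01 j.
  by rewrite !coordE /=; split; [nra|nra|ring].
have I2 (i : 'I_2) : i = ord0 \/ i = ord_max.
  by case: i => -[|[|//]] h; [left|right]; apply: val_inj.
have other01 (i j : complete_graph 2) y : i != j -> other_edges p i j y -> range p y.
  move=> ij /other_edgesP[//|[a [b [ab n1 n2 _]]]]; exfalso; move: ab n1 n2 ij.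
  by rewrite /adj /= /complete_rel; case: (I2 a) (I2 b) (I2 i) (I2 j)
    => -> [] -> [] -> [] ->; rewrite ?eqxx.
have vis01 : visible p (ord0 : complete_graph 2) (ord_max : complete_graph 2).
  exists (1 / 2, 0), (1 / 2, 1); split.
  - split.
      have -> : (1 / 2, 0) = pt (p ord0) (p ord_max) (1 / 2).
        by apply: pair_eq; rewrite !coordE /=; ring.
      by apply: segment_pt; lra.
    move=> /other01[] // i _ [h]; have : (i : nat)%:R = 1 / 2 :> R by [].
    by case: (I2 i) => -> /=; rewrite ?mulr0n ?mulr1n; lra.
  - by move=> t t0 t1 /DE[_ _]; rewrite !coordE /=; lra.
  - apply: (@escapes_ray _ _ _ (0, 1) 1) => //.
      by apply/eqP => -[/eqP]; rewrite oner_eq0.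
    move=> t d t0 /DE[_ _ d2]; apply: le_trans (norm_coord _).2.
    by rewrite !coordE d2 /=; apply: le_trans (ler_norm _); lra.
  - by rewrite /orient /=; apply: lt0r_neq0; lra.
  - move=> c; rewrite /adj /= /complete_rel => c0 c1.
    by exfalso; move: c0 c1; case: (I2 c) => ->; rewrite eqxx.
split.
- by move=> i j [/eqP]; rewrite eqr_nat => /eqP/val_inj.
- move=> a b w; rewrite /adj /= /complete_rel => ab _; move: ab.
  by case: (I2 a) (I2 b) (I2 w) => -> [] -> [] ->; rewrite ?eqxx // => _;
    first [by left | by right].
- by move=> a b ab; rewrite /adj /= /complete_rel ab.
- move=> a b; rewrite /adj /= /complete_rel.
  by case: (I2 a) (I2 b) => -> [] ->; rewrite ?eqxx // => _; exact: visibleC.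
- have slot_ray (a b : complete_graph 2) :
    (forall t d, 0 <= t -> drawing_set p d ->
       1 <= `|(p b + 1 *: (p b - p a) + t *: (p b - p a) - d).1|) ->
    (forall t, 0 < t -> ~ drawing_set p (pt (p b) (p b + 1 *: (p b - p a)) t)) ->
    a != b -> slot p a b.
    move=> far cl ab; exists 1; split => //; first by move=> t t0 _; exact: cl.
    apply: (@escapes_ray _ _ _ (p b - p a) 1) => //.
      by rewrite subr_eq0; apply/eqP => -[/eqP]; rewrite eqr_nat => /eqP/val_inj/eqP;
        rewrite eq_sym (negbTE ab).
    by move=> t d t0 Dd; apply: le_trans (norm_coord _).1; exact: far.
  move=> a b; change (is_true (a != b) -> slot p a b) => ab.
  apply: slot_ray => // [t d t0 /DE[d0 d1 _]|t t0 /DE[]];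
    move: ab; case: (I2 a) (I2 b) => -> [] ->; rewrite ?eqxx // => _;
    rewrite !coordE /=.
  + by apply: le_trans (ler_norm _); lra.
  + by rewrite -normrN; apply: le_trans (ler_norm _); lra.
  + by move=> _; lra.
  + by lra.
- by [].
- by move=> a b ab; rewrite /= -[_ != _]/(adj a b) ab.
- by move=> b; case: (I2 b) => ->; [exists ord_max|exists ord0].
- move=> a b c /=; case: (I2 a) (I2 b) (I2 c) => -> [] -> [] ->; rewrite ?eqxx //.
Qed.

Lemma K3_extend_K2 :
  isomorphic (@extend (complete_graph 2) ord0 ord_max) (complete_graph 3).
Proof.
have I2 (i : 'I_2) : (i == ord0) || (i == ord_max) by case: i => -[|[|//]].
exists (oapp (lift (ord_max : 'I_3)) ord_max); split.
  exists (unlift ord_max) => [[i|]|i] /=; rewrite ?liftK ?unlift_none //.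
  by case: unliftP => [j ->|->].
move=> [i|] [j|]; rewrite /adj /= /complete_rel ?(inj_eq (@lift_inj _ _)) ?eqxx //.
- by rewrite I2 eq_sym neq_lift.
- by rewrite I2 neq_lift.
Qed.

(** Stacking needs the later endpoint in second place, which the given order of [u] and [v] may
    violate. *)
Lemma extend_swap (H : sgraph) (u v : H) : isomorphic (extend v u) (extend u v).
Proof.
exists id; split; first by exists id.
by move=> [a|] [b|] //=; rewrite /adj /= orbC.
Qed.

Lemma two_tree_growable (R : realType) (G : sgraph) : two_tree G ->
  exists (p : G -> R * R) (L : rel G), growable p L.
Proof.
elim=> {G} [|H u v _ [p [L gr]] uv|G H GH _ IH].
- apply: (growable_iso K3_extend_K2).
  by apply: (growable_extend (growable_K2 R)).
- have [Luv|Lvu] := orP (grow_cover gr uv); first exact: (growable_extend gr Luv).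
  exact: (growable_iso (extend_swap u v) (growable_extend gr Lvu)).
- exact: (growable_iso GH IH).
Qed.

Theorem theorem2 (R : realType) (G : sgraph) (hG : two_tree G) :
  exists p : G -> (R * R)%type,
    [/\ is_OOR p, is_reducible p & forall v : G, vertex_on_outer_face p v].
Proof.
have [p [L gr]] := two_tree_growable R hG.
by exists p; exact: (growable_OOR gr).
Qed.
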